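(* Let $X\subset S^{N-1}_{\mathbb C}$ be a closed $O_2$-invariant subset, let $X^-=X\cap\mathbb TS^{N-1}_{\mathbb R}$, and for $\times\in\{**,*,\circ,\#\}$ let $X^\times\subset S^{N-1}_{\mathbb C,\times}$ be the conjugation-stable lift of $PX$ (if $\times=**,*$) or of $PX^-$ (if $\times=\circ,\#$). Then $$C(X^\times)=C(S^{N-1}_{\mathbb C,\times})/\langle I,J\rangle,$$ where $\langle I,J\rangle$ is the closed two-sided ideal generated by $I\cup J$, and where $I$ and $J$ are the linear subspaces of $C(S^{N-1}_{\mathbb C,\times})$ given by the images of $$\begin{cases}\ker[C(P^N_{\mathbb C})\to C(PX)]&\text{for }\times=**,*\\ \ker[C(P^N_{\mathbb R})\to C(PX^-)]&\text{for }\times=\circ,\#\end{cases}$$ via the embedding sending the $(i,j)$ coordinate to $p_{ij}=z_iz_j^*$ (for $I$), respectively via the embedding sending the $(i,j)$ coordinate to $q_{ij}=z_j^*z_i$ (for $J$).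
   Context: Noncommutative compact spaces are formal duals of unital $C^*$-algebras. $C(S^{N-1}_{\mathbb C,+})$ is the universal $C^*$-algebra generated by $z_1,\ldots,z_N$ with $\sum_iz_iz_i^*=\sum_iz_i^*z_i=1$. Closed subspaces $Z\subset S^{N-1}_{\mathbb C,+}$ correspond to quotient $C^*$-algebras $C(Z)$, with coordinates still denoted $z_i$; $Z\subset Y$ means that there is a morphism $C(Y)\to C(Z)$ mapping $z_i\mapsto z_i$. Subspaces: - $S^{N-1}_{\mathbb C,*}$: relations $ab^*c=cb^*a$, $a,b,c\in\{z_i\}$; - $S^{N-1}_{\mathbb C,**}$: relations $abc=cba$, $a,b,c\in\{z_i,z_i^*\}$; - $S^{N-1}_{\mathbb C,\#}$: relations $ab^*=ba^*$, $a^*b=b^*a$, $a,b\in\{z_i\}$; - $S^{N-1}_{\mathbb C,\circ}$: the relations of both $S^{N-1}_{\mathbb C,\#}$ and $S^{N-1}_{\mathbb C,**}$. $S^{N-1}_{\mathbb C}\subset\mathbb C^N$ is the usual unit sphere, and $\mathbb TS^{N-1}_{\mathbb R}=\{ux\,|\,u\in\mathbb T,x\in S^{N-1}_{\mathbb R}\}\subset S^{N-1}_{\mathbb C}$. $P^N_{\mathbb C}$ (resp. $P^N_{\mathbb R}$) denotes the usual projective space, viewed as the space of rank one orthogonal projections $p=(p_{ij})$ in $M_N(\mathbb C)$ (resp. $M_N(\mathbb R)$), with coordinate functions $p_{ij}$. For a closed subspace $Z\subset S^{N-1}_{\mathbb C,+}$, the projective version $PZ$ is the dual of the subalgebra $C(PZ)\subset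 C(Z)$ generated by the elements $p_{ij}=z_iz_j^*$. In general there is also a second projective version, given by the elements $q_{ij}=z_j^*z_i$; to deal with this, one restricts to conjugation-stable spaces, defined below. It is known that the projective version of $S^{N-1}_{\mathbb C,\times}$ is $P^N_{\mathbb C}$ for $\times=**,*$ and $P^N_{\mathbb R}$ for $\times=\circ,\#$. A closed subset $X\subset S^{N-1}_{\mathbb C}$ is called $O_2$-invariant if it is invariant under $z\mapsto uz$ for all $u\in\mathbb T$, and under $z\mapsto\bar z$. A closed subspace $Z\subset S^{N-1}_{\mathbb C,+}$ is called conjugation-stable when $C(Z)$ has an anti-automorphism given by $z_i\mapsto z_i^*$. The conjugation-stable lift to $S^{N-1}_{\mathbb C,\times}$ of a closed subspace $P$ of $P^N_{\mathbb C}$ (if $\times=**,*$) or of $P^N_{\mathbb R}$ (if $\times=\circ,\#$) is the biggest conjugation-stable closed subspace of $S^{N-1}_{\mathbb C,\times}$ having $P$ as projective version. *)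

(* Defs.v *)
From HB Require Import structures.
From mathcomp Require Import all_boot all_order all_algebra.
From mathcomp Require Import complex.
From mathcomp Require Import all_classical all_reals all_analysis.

Set Implicit Arguments.
Unset Strict Implicit.
Unset Printing Implicit Defensive.

Import Order.TTheory GRing.Theory Num.Theory.
Import numFieldNormedType.Exports.

Local Open Scope classical_set_scope.
Local Open Scope ring_scope.

HB.instance Definition _ (R : realType) := NormedModule.copy R[i] R[i]^o.

(* Unital complex star-algebras, the zero algebra (functions on the empty
   space) included.  The product is a field of its own because the algebras of
   the MathComp hierarchy satisfy 1 != 0. *)
HB.mixin Record isStarAlgebra (R : realType) A & GRing.Lmodule R[i] A := {
  sone : A ;
  smul : A -> A -> A ;
  star : A -> A ;
  smulA : forall a b c : A, smul a (smul b c) = smul (smul a b) c ;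
  smul1l : forall a : A, smul sone a = a ;
  smul1r : forall a : A, smul a sone = a ;
  smulDl : forall a b c : A, smul (a + b) c = smul a c + smul b c ;
  smulDr : forall a b c : A, smul a (b + c) = smul a b + smul a c ;
  smulZl : forall (k : R[i]) (a b : A), smul (k *: a) b = k *: smul a b ;
  smulZr : forall (k : R[i]) (a b : A), smul a (k *: b) = k *: smul a b ;
  starK : forall a : A, star (star a) = a ;
  starD : forall a b : A, star (a + b) = star a + star b ;
  starZ : forall (k : R[i]) (a : A), star (k *: a) = k^* *: star a ;
  starM : forall a b : A, star (smul a b) = smul (star b) (star a)
}.

#[short(type="starAlgType")]
HB.structure Definition StarAlgebra (R : realType) :=
  { A of GRing.Lmodule R[i] A & isStarAlgebra R A }.

Arguments sone {R A} : rename.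
Arguments smul {R A} : rename.
Arguments star {R A} : rename.

Declare Scope star_scope.
Delimit Scope star_scope with star.
Local Open Scope star_scope.
Notation "a ⋅ b" := (smul a b) (at level 40, left associativity) : star_scope.
Notation "a ^*'" := (star a) (at level 2, format "a ^*'") : star_scope.

HB.mixin Record isCStarAlgebra (R : realType) A
    & StarAlgebra R A & CompleteNormedModule R[i] A := {
  cstar_normM : forall a b : A, `|a ⋅ b| <= `|a| * `|b| ;
  cstar_norm : forall a : A, `|a^*' ⋅ a| = `|a| ^+ 2
}.

#[short(type="cstarAlgType")]
HB.structure Definition CStarAlgebra (R : realType) :=
  { A of StarAlgebra R A & CompleteNormedModule R[i] A & isCStarAlgebra R A }.

Section Morphisms.
Variable R : realType.

Record star_morphism (A B : starAlgType R) (f : A -> B) : Prop := {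
  star_morphism_linear : linear f ;
  star_morphism1 : f sone = sone ;
  star_morphismM : forall a b, f (a ⋅ b) = f a ⋅ f b ;
  star_morphism_star : forall a, f a^*' = (f a)^*'
}.

Record star_antiautomorphism (A : starAlgType R) (f : A -> A) : Prop := {
  antiauto_bij : bijective f ;
  antiauto_linear : linear f ;
  antiauto1 : f sone = sone ;
  antiautoM : forall a b, f (a ⋅ b) = f b ⋅ f a ;
  antiauto_star : forall a, f a^*' = (f a)^*'
}.

Record cstar_subalgebra (A : cstarAlgType R) (B : set A) : Prop := {
  subalg1 : B sone ;
  subalgP : forall (k : R[i]) a b, B a -> B b -> B (k *: a + b) ;
  subalgM : forall a b, B a -> B b -> B (a ⋅ b) ;
  subalg_star : forall a, B a -> B a^*' ;
  subalg_closed : closed B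
}.

Definition cstar_generated (A : cstarAlgType R) (G : set A) : set A :=
  smallest (@cstar_subalgebra A) G.

(* Stability under scalars follows from [idealMl], A being unital. *)
Record closed_ideal (A : cstarAlgType R) (K : set A) : Prop := {
  ideal0 : K 0 ;
  idealD : forall a b, K a -> K b -> K (a + b) ;
  idealMl : forall a b, K b -> K (a ⋅ b) ;
  idealMr : forall a b, K a -> K (a ⋅ b) ;
  ideal_closed : closed K
}.

Definition ideal_generated (A : cstarAlgType R) (G : set A) : set A :=
  smallest (@closed_ideal A) G.

End Morphisms.

(* C(K) as a star-algebra only: morphisms do not mention the norm. *)
Definition cfun (R : realType) (K : topologicalType) := continuousType K R[i].

Section ContinuousFunctions.
Variables (R : realType) (K : topologicalType).
Implicit Types f g h : cfun R K.

Definition cfun_fun f : K -> R[i] := Continuous.sort f.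
Coercion cfun_fun : cfun >-> Funclass.

Definition mkcfun (f : K -> R[i]) (cf : continuous f) : cfun R K :=
  mkcts cf : continuousType K R[i].

Lemma cfunP f g : f =1 g -> f = g.
Proof. by move/continuousEP. Qed.

Lemma cfun_continuous f : continuous f.
Proof. exact: cts_fun. Qed.

HB.instance Definition _ := Choice.on (cfun R K).

Fact cfun0_subproof : continuous (fun _ : K => 0 : R[i]).
Proof. by move=> x; exact: cvg_cst. Qed.
Fact cfun1_subproof : continuous (fun _ : K => 1 : R[i]).
Proof. by move=> x; exact: cvg_cst. Qed.
Fact cfunD_subproof f g : continuous (fun x => f x + g x).
Proof. by move=> x; apply: cvgD; exact: cfun_continuous. Qed.
Fact cfunN_subproof f : continuous (fun x => - f x).
Proof. by move=> x; apply: cvgN; exact: cfun_continuous. Qed.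
Fact cfunM_subproof f g : continuous (fun x => f x * g x).
Proof. by move=> x; apply: cvgM; exact: cfun_continuous. Qed.
Fact cfunZ_subproof (k : R[i]) f : continuous (fun x => k * f x).
Proof. by move=> x; apply: cvgM; [exact: cvg_cst|exact: cfun_continuous]. Qed.
Fact cfun_conj_subproof f : continuous (fun x => (f x)^*).
Proof.
move=> x; apply/cvgrPdist_lt => e e0.
have /cvgrPdist_lt /(_ e e0) := @cfun_continuous f x.
by apply: filterS => y; rewrite -rmorphB norm_conjC.
Qed.

Definition cfun0 := mkcfun cfun0_subproof.
Definition cfun1 := mkcfun cfun1_subproof.
Definition cfunD f g := mkcfun (@cfunD_subproof f g).
Definition cfunN f := mkcfun (@cfunN_subproof f).
Definition cfunM f g := mkcfun (@cfunM_subproof f g).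
Definition cfunZ k f := mkcfun (@cfunZ_subproof k f).
Definition cfun_conj f := mkcfun (@cfun_conj_subproof f).

Fact cfunDA : associative cfunD.
Proof. by move=> f g h; apply: cfunP => x; exact: addrA. Qed.
Fact cfunDC : commutative cfunD.
Proof. by move=> f g; apply: cfunP => x; exact: addrC. Qed.
Fact cfun0D : left_id cfun0 cfunD.
Proof. by move=> f; apply: cfunP => x; exact: add0r. Qed.
Fact cfunND : left_inverse cfun0 cfunN cfunD.
Proof. by move=> f; apply: cfunP => x; exact: addNr. Qed.

HB.instance Definition _ :=
  GRing.isZmodule.Build (cfun R K) cfunDA cfunDC cfun0D cfunND.

Fact cfunZA a b f : cfunZ a (cfunZ b f) = cfunZ (a * b) f.
Proof. by apply: cfunP => x; exact: mulrA. Qed.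
Fact cfun1Z : left_id 1 cfunZ.
Proof. by move=> f; apply: cfunP => x; exact: mul1r. Qed.
Fact cfunZDr : right_distributive cfunZ +%R.
Proof. by move=> a f g; apply: cfunP => x; exact: mulrDr. Qed.
Fact cfunZDl f : {morph cfunZ^~ f : a b / a + b}.
Proof. by move=> a b; apply: cfunP => x; exact: mulrDl. Qed.

HB.instance Definition _ :=
  GRing.Zmodule_isLmodule.Build R[i] (cfun R K) cfunZA cfun1Z cfunZDr cfunZDl.

Fact cfunMA f g h : cfunM f (cfunM g h) = cfunM (cfunM f g) h.
Proof. by apply: cfunP => x; exact: mulrA. Qed.
Fact cfun1M f : cfunM cfun1 f = f.
Proof. by apply: cfunP => x; exact: mul1r. Qed.
Fact cfunM1 f : cfunM f cfun1 = f.
Proof. by apply: cfunP => x; exact: mulr1. Qed.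
Fact cfunMDl f g h : cfunM (f + g) h = cfunM f h + cfunM g h.
Proof. by apply: cfunP => x; exact: mulrDl. Qed.
Fact cfunMDr f g h : cfunM f (g + h) = cfunM f g + cfunM f h.
Proof. by apply: cfunP => x; exact: mulrDr. Qed.
Fact cfunMZl (k : R[i]) f g : cfunM (k *: f) g = k *: cfunM f g.
Proof. by apply: cfunP => x; exact/esym/mulrA. Qed.
Fact cfunMZr (k : R[i]) f g : cfunM f (k *: g) = k *: cfunM f g.
Proof. by apply: cfunP => x; exact: mulrCA. Qed.
Fact cfun_conjK f : cfun_conj (cfun_conj f) = f.
Proof. by apply: cfunP => x; exact: conjCK. Qed.
Fact cfun_conjD f g : cfun_conj (f + g) = cfun_conj f + cfun_conj g.
Proof. by apply: cfunP => x; exact: rmorphD. Qed.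
Fact cfun_conjZ (k : R[i]) f : cfun_conj (k *: f) = k^* *: cfun_conj f.
Proof. by apply: cfunP => x; exact: rmorphM. Qed.
Fact cfun_conjM f g : cfun_conj (cfunM f g) = cfunM (cfun_conj g) (cfun_conj f).
Proof. by apply: cfunP => x; exact: etrans (rmorphM _ _ _) (mulrC _ _). Qed.

HB.instance Definition _ := isStarAlgebra.Build R (cfun R K)
  cfunMA cfun1M cfunM1 cfunMDl cfunMDr cfunMZl cfunMZr
  cfun_conjK cfun_conjD cfun_conjZ cfun_conjM.

End ContinuousFunctions.

Section ClassicalSpaces.
Variables (R : realType) (N : nat).

Definition rsphere : set 'cV[R]_N := [set x | \sum_i x i 0 ^+ 2 = 1].

Definition csphere : set 'cV[R[i]]_N := [set z | \sum_i `|z i 0| ^+ 2 = 1].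

Definition torus_rsphere : set 'cV[R[i]]_N :=
  [set z | exists (u : R[i]) (x : 'cV[R]_N),
     [/\ `|u| = 1, rsphere x & z = u *: map_mx (real_complex R) x]].

Definition O2_invariant (X : set 'cV[R[i]]_N) : Prop :=
  (forall (u : R[i]) z, `|u| = 1 -> X z -> X (u *: z)) /\
  (forall z : 'cV[R[i]]_N, X z -> X (map_mx Num.conj z)).

Definition cproj_space : set 'M[R[i]]_N :=
  [set p | [/\ map_mx Num.conj p^T = p, p *m p = p & \rank p = 1%N]].

(* The rank one projections of M_N(R), seen in M_N(C). *)
Definition rproj_space : set 'M[R[i]]_N :=
  map_mx (real_complex R) @`
    [set p : 'M[R]_N | [/\ p^T = p, p *m p = p & \rank p = 1%N]].

(* The classical PX: here C(PX), generated in C(X) by the functions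
   z_i (z_j)^*, is the algebra of functions on the image of X under the map
   sending z to the projection onto its line. *)
Definition classical_projective (X : set 'cV[R[i]]_N) : set 'M[R[i]]_N :=
  (fun z : 'cV[R[i]]_N => \matrix_(i, j) (z i 0 * (z j 0)^*)) @` X.

Section Coordinates.
Variables (P : set 'M[R[i]]_N) (i j : 'I_N).

Fact coordinate_subproof : continuous (fun p : P => (set_val p : 'M[R[i]]_N) i j).
Proof.
move=> p; apply: (@continuous_comp _ _ _ (set_val : P -> _) (fun M => M i j)).
  exact: initial_continuous.
exact: coord_continuous.
Qed.

Definition coordinate : cfun R P := mkcfun coordinate_subproof.

End Coordinates.

(* ker[C(P) -> C(Q)] for Q contained in P. *)
Definition vanishing (P Q : set 'M[R[i]]_N) : set (cfun R P) :=
  [set f | forall p : P, Q (set_val p) -> f p = 0].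

End ClassicalSpaces.

Arguments rsphere R N : clear implicits.
Arguments csphere R N : clear implicits.
Arguments torus_rsphere R N : clear implicits.
Arguments cproj_space R N : clear implicits.
Arguments rproj_space R N : clear implicits.
Arguments vanishing {R N} P Q.

Section NoncommutativeSpaces.
Variables (R : realType) (N : nat).

(* A noncommutative space Z, given by C(Z) and its coordinates z_i. *)
Record nc_space := NCSpace {
  nc_alg :> cstarAlgType R ;
  nc_coord : 'I_N -> nc_alg
}.

Record nc_morphism (Y Z : nc_space) (f : Y -> Z) : Prop := {
  nc_morphism_star : star_morphism f ;
  nc_morphism_coord : forall i, f (nc_coord Y i) = nc_coord Z i
}.

Definition nc_subspace (Z Y : nc_space) : Prop :=
  exists f : Y -> Z, nc_morphism f.

Definition nc_closed_subspace (Z Y : nc_space) : Prop :=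
  exists2 f : Y -> Z, nc_morphism f & range f = setT.

Definition nc_quotient (Y : nc_space) (K : set Y) (Z : nc_space) : Prop :=
  exists f : Y -> Z, [/\ nc_morphism f, range f = setT & f @^-1` [set 0] = K].

Definition conjugation_stable (Z : nc_space) : Prop :=
  exists2 f : Z -> Z, star_antiautomorphism f
    & forall i, f (nc_coord Z i) = (nc_coord Z i)^*'.

Definition pcoord (Z : nc_space) (i j : 'I_N) : Z :=
  nc_coord Z i ⋅ (nc_coord Z j)^*'.

Definition qcoord (Z : nc_space) (i j : 'I_N) : Z :=
  (nc_coord Z j)^*' ⋅ nc_coord Z i.

Record coordinate_embedding (P : set 'M[R[i]]_N) (A : starAlgType R)
    (e : 'I_N -> 'I_N -> A) (f : cfun R P -> A) : Prop := {
  coordinate_embedding_star : star_morphism f ;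
  coordinate_embedding_inj : injective f ;
  coordinate_embedding_coord : forall i j, f (coordinate P i j) = e i j
}.

(* [f] identifies C(P) with the subalgebra C(PZ) of C(Z). *)
Definition projective_identification (Z : nc_space) (P : set 'M[R[i]]_N)
    (f : cfun R P -> Z) : Prop :=
  coordinate_embedding (pcoord Z) f /\
  range f = cstar_generated [set pcoord Z i j | i in setT & j in setT].

Definition projective_version (Z : nc_space) (P : set 'M[R[i]]_N) : Prop :=
  exists f : cfun R P -> Z, projective_identification f.

Definition lift_candidate (S : nc_space) (P : set 'M[R[i]]_N)
    (Z : nc_space) : Prop :=
  [/\ nc_closed_subspace Z S, conjugation_stable Z & projective_version Z P].

Definition conjugation_stable_lift (S : nc_space) (P : set 'M[R[i]]_N)
    (Z : nc_space) : Prop :=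
  lift_candidate S P Z /\
  forall Z' : nc_space, lift_candidate S P Z' -> nc_subspace Z' Z.

(* In this order: **, *, o, #. *)
Inductive sphere_kind := DoubleStar | Star | Circ | Sharp.

Definition sphere_relations (Z : nc_space) : Prop :=
  let z := nc_coord Z in
  \sum_i z i ⋅ (z i)^*' = sone /\ \sum_i (z i)^*' ⋅ z i = sone.

Definition star_relations (Z : nc_space) : Prop :=
  let z := nc_coord Z in
  forall i j k, z i ⋅ (z j)^*' ⋅ z k = z k ⋅ (z j)^*' ⋅ z i.

Definition double_star_relations (Z : nc_space) : Prop :=
  let G : set Z := range (nc_coord Z) `|` range (fun i => (nc_coord Z i)^*') in
  forall a b c, G a -> G b -> G c -> a ⋅ b ⋅ c = c ⋅ b ⋅ a.

Definition sharp_relations (Z : nc_space) : Prop :=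
  let z := nc_coord Z in
  forall i j, z i ⋅ (z j)^*' = z j ⋅ (z i)^*' /\
              (z i)^*' ⋅ z j = (z j)^*' ⋅ z i.

Definition kind_relations (x : sphere_kind) (Z : nc_space) : Prop :=
  match x with
  | DoubleStar => double_star_relations Z
  | Star => star_relations Z
  | Circ => sharp_relations Z /\ double_star_relations Z
  | Sharp => sharp_relations Z
  end.

Definition sphere_kind_relations (x : sphere_kind) (Z : nc_space) : Prop :=
  sphere_relations Z /\ kind_relations x Z.

(* [S] is the sphere of kind [x]: C(S) is the universal C*-algebra on its
   relations. *)
Definition nc_sphere (x : sphere_kind) (S : nc_space) : Prop :=
  sphere_kind_relations x S /\
  forall Z : nc_space, sphere_kind_relations x Z ->
    exists! f : S -> Z, nc_morphism f.

Definition kind_proj_space (x : sphere_kind) : set 'M[R[i]]_N :=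
  match x with
  | DoubleStar | Star => cproj_space R N
  | Circ | Sharp => rproj_space R N
  end.

(* PX for **, * and PX^- for o, #. *)
Definition kind_projective (x : sphere_kind) (X : set 'cV[R[i]]_N) :
    set 'M[R[i]]_N :=
  match x with
  | DoubleStar | Star => classical_projective X
  | Circ | Sharp => classical_projective (X `&` torus_rsphere R N)
  end.

End NoncommutativeSpaces.

Arguments kind_proj_space R N x : clear implicits.

(* Main.v *)
Require Import Defs.
From HB Require Import structures.
From mathcomp Require Import all_boot all_order all_algebra.
From mathcomp Require Import complex.
From mathcomp Require Import all_classical all_reals all_analysis.
From mathcomp Require Import ring lra.
Import numFieldNormedType.Exports.

(* The relation [p_ij z_k = z_k q_ij] holds in all four spheres, hence so does
   [ip f * z_k = z_k * iq f] for every continuous [f].  As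
   [sum_k z_k^* z_k = 1], this gives
   [iq f = sum_k z_k^* * ip f * z_k]: the ideal generated by [I] and
   [J] is the one generated by [I], and it is killed by a quotient of [C(S)] as
   soon as the projective version of this quotient is [PX].  Conversely the
   quotient by this ideal is conjugation-stable because [z_i -> z_i^*] acts on
   the [ip f] by transposition, and its projective version is [PX] because the
   points of [X] (of [X^-] for o and #) give characters of [C(S)] which kill
   [I] and evaluate [ip f] at the corresponding point of [PX].

   The facts needed on C*-algebras are obtained without spectral theory: unitary
   elements have norm at most 1, so that expressing a self-adjoint [h] with
   [|h| < 1] through unitaries, by a square root of [1 - h^2] or by the Cayley
   transform, gives the contractivity of star-morphisms and approximate units. *)

(** The commutation of [p_ij] with [z_k] is [a b^* c = c b^* a] for [a = z_i], [b = z_j], [c = z_k],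
    so it is known on coordinates only. What extends it to all continuous functions is the
    description of the range of [ip] as the closed algebra generated by the [p_ij]: a property of
    functions that is true of coordinates and stable under algebra operations and uniform limits
    holds on all of C(P). As [cfun] carries no norm, uniform limits are expressed pointwise and the
    isometry of [ip] has to be established.

    The obstacle is to have the quotient by the ideal as an actual C*-algebra containing C(PX).
    Approximate units serve the C*-identity of the quotient norm. A map from C(PX) to the quotient
    exists only if functions on [PX] extend to [P], whence the closedness of [PX] and the Tietze
    theorem.

    Once this quotient is a candidate, any lift maps to it by maximality; that map bounds the kernel
    of C(S) -> C(Y) from above, for [Y] the lift, and the projective version of [Y] bounds it from
    below. *)

Set Implicit Arguments.
Unset Strict Implicit.
Unset Printing Implicit Defensive.

Import Order.TTheory GRing.Theory Num.Theory.

Local Open Scope classical_set_scope.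
Local Open Scope complex_scope.
Local Open Scope ring_scope.
Local Open Scope star_scope.

(** * Norms, resolvents and square roots in C*-algebras *)

Section RealNorm.
Variables (R : realType) (V : normedModType R[i]).
Implicit Types u v w : V.

(** The norm takes its values in [R[i]]; its real part moves estimates to the ordered field [R],
    where [lra] and [nra] apply. *)
Definition nrm v : R := complex.Re `|v|.

Lemma nrmE v : `|v| = (nrm v)%:C.
Proof. by rewrite RRe_real// ger0_real. Qed.

Lemma nrm_ge0 v : 0 <= nrm v.
Proof. by rewrite -ler0c -nrmE. Qed.

Lemma nrm_eq0 v : (nrm v == 0) = (v == 0).
Proof. by rewrite -(normr_eq0 v) nrmE (inj_eq (@complexI _) _ 0). Qed.

Lemma nrm0 : nrm (0 : V) = 0.
Proof. by apply/eqP; rewrite nrm_eq0. Qed.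

Lemma nrmD u v : nrm (u + v) <= nrm u + nrm v.
Proof. by rewrite -lecR rmorphD/= -!nrmE ler_normD. Qed.

Lemma nrmN v : nrm (- v) = nrm v.
Proof. by rewrite /nrm normrN. Qed.

Lemma nrmC u v : nrm (u - v) = nrm (v - u).
Proof. by rewrite -nrmN opprB. Qed.

Lemma nrmB u v w : nrm (u - w) <= nrm (u - v) + nrm (v - w).
Proof. by apply: le_trans (nrmD _ _); rewrite addrA subrK. Qed.

Lemma nrm_ball v (e : R) u : ball v e%:C u <-> nrm (v - u) < e.
Proof. by rewrite -ball_normE /= nrmE ltcR. Qed.

Lemma posC (e : R[i]) : 0 < e -> exists2 r : R, 0 < r & e = r%:C.
Proof.
move=> e0; exists (complex.Re e); last by rewrite RRe_real// gtr0_real.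
by rewrite -ltcR RRe_real// gtr0_real.
Qed.

Lemma nrm_nbhs v (A : set V) :
  nbhs v A <-> exists2 e : R, 0 < e & forall u, nrm (v - u) < e -> A u.
Proof.
rewrite -nbhs_ballE; split => [[e /posC[r r0 ->] sA]|[e e0 sA]].
  by exists r => // u /nrm_ball; exact: sA.
by exists e%:C; [rewrite /= ltcR|move=> u /nrm_ball; exact: sA].
Qed.

Lemma nrm_closedP (B : set V) : closed B <->
  forall v, (forall e, 0 < e -> exists2 b, B b & nrm (v - b) < e) -> B v.
Proof.
split=> [cB v vB|cB v vB].
  apply: cB => A /nrm_nbhs[e /vB[b Bb ve] sA].
  by exists b; split => //; exact: sA.
apply: cB => e e0; have [|b [Bb vb]] := vB [set u | nrm (v - u) < e].
  by apply/nrm_nbhs; exists e.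
by exists b.
Qed.

Lemma nrm_eq0P v : (forall e, 0 < e -> nrm v <= e) -> v = 0.
Proof.
move=> ve; apply/eqP; rewrite -nrm_eq0 eq_le nrm_ge0 andbT.
by apply/ler_addgt0Pl => e e0; rewrite addr0; exact: ve.
Qed.

End RealNorm.

Lemma nrmZ (R : realType) (V : normedModType R[i]) (k : R[i]) (v : V) :
  nrm (k *: v) = nrm (k : R[i]^o) * nrm v.
Proof. by apply: (@complexI R); rewrite rmorphM/= -!nrmE normrZ. Qed.

Lemma nrmZr (R : realType) (V : normedModType R[i]) (r : R) (v : V) :
  nrm (r%:C *: v) = `|r| * nrm v.
Proof.
rewrite nrmZ; congr (_ * _); apply: (@complexI R).
by rewrite -nrmE normc_def /= expr0n addr0 sqrtr_sqr.
Qed.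

Lemma nrmZi (R : realType) (V : normedModType R[i]) (r : R) (v : V) :
  nrm (r *i *: v) = `|r| * nrm v.
Proof.
rewrite nrmZ; congr (_ * _); apply: (@complexI R).
by rewrite -nrmE normc_def /= expr0n add0r sqrtr_sqr.
Qed.

Lemma geometric_small (R : realType) (C q e : R) :
  0 <= C -> 0 <= q < 1 -> 0 < e -> exists n, C * q ^+ n < e.
Proof.
move=> C0 /andP[q0 q1] e0; have q1' : `|q| < 1 by rewrite ger0_norm.
have := cvg_geometric C q1'.
move=> /cvgrPdist_lt /(_ e e0)[n _ /(_ n) /= /(_ (leqnn n))].
rewrite sub0r normrN ger0_norm; last by rewrite (mulr_ge0 C0)// exprn_ge0.
by exists n.
Qed.

(** * Geometric sequences and fixed points of contractions *)

Section Completeness.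
Variables (R : realType) (V : completeNormedModType R[i]).

Lemma nrm_complete (u : nat -> V) :
  (forall e, 0 < e -> exists n, forall m, (n <= m)%N -> nrm (u n - u m) < e) ->
  exists l, forall e, 0 < e ->
    exists n, forall m, (n <= m)%N -> nrm (l - u m) < e.
Proof.
move=> uC; have : cauchy_ex (u @ \oo).
  move=> _ /posC[e e0 ->]; have [n un] := uC _ e0.
  by exists (u n), n => // m /= nm; apply/nrm_ball; exact: un.
move=> /cauchy_exP /cauchy_cvg /cvg_ex[l ul]; exists l => e e0.
have /ul [n _ un] : nbhs l [set v | nrm (l - v) < e].
  by apply/nrm_nbhs; exists e.
by exists n => m; exact: un.
Qed.

Lemma nrm_geometric (u : nat -> V) (C q : R) :
  0 <= q < 1 -> (forall n, nrm (u n - u n.+1) <= C * q ^+ n) ->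
  exists l, forall e, 0 < e -> exists n, forall m, (n <= m)%N ->
    nrm (l - u m) < e.
Proof.
move=> q01 uq; have /andP[q0 q1] := q01; apply: nrm_complete => e e0.
have C0 : 0 <= C.
  by have := uq 0%N; rewrite expr0 mulr1; apply: le_trans; exact: nrm_ge0.
pose D := C / (1 - q).
have D0 : 0 <= D by rewrite divr_ge0// subr_ge0 ltW.
(* By the choice of [D], [C q^n = D (q^n - q^(n+1))], so the increments telescope. *)
have unm n k : nrm (u n - u (n + k)%N) <= D * (q ^+ n - q ^+ (n + k)).
  elim: k => [|k IH]; first by rewrite addn0 !subrr mulr0 nrm0.
  rewrite addnS; apply: (le_trans (nrmB _ (u (n + k)%N) _)).
  apply: (le_trans (lerD IH (uq _))).
  have -> : C = D * (1 - q) by rewrite divfK// subr_eq0 gt_eqF.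
  by rewrite exprS le_eqVlt; apply/orP; left; apply/eqP; ring.
have [n qn] := geometric_small D0 q01 e0.
exists n => m nm; rewrite -(subnKC nm).
apply: (le_lt_trans (unm _ _)); apply: le_lt_trans qn.
by apply: ler_wpM2l => //; rewrite gerBl exprn_ge0.
Qed.

(** Produces both the inverse of [1 - a] and the square root of [1 - h^2]. The closed set [U]
    carries over to the fixed point the properties preserved by [T], such as being self-adjoint. *)
Lemma contraction_fixpoint (U : set V) (T : V -> V) (q : R) x0 :
  closed U -> U x0 -> (forall x, U x -> U (T x)) -> 0 <= q < 1 ->
  (forall x y, U x -> U y -> nrm (T x - T y) <= q * nrm (x - y)) ->
  exists2 x, U x & T x = x.
Proof.
move=> cU Ux0 TU q01 Tq; have /andP[q0 q1] := q01; pose u n := iter n T x0.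
have Uu n : U (u n) by elim: n => //= n; exact: TU.
have uq n : nrm (u n - u n.+1) <= nrm (x0 - T x0) * q ^+ n.
  elim: n => [|n IH]; first by rewrite expr0 mulr1.
  apply: (le_trans (Tq _ _ (Uu n) (Uu n.+1))).
  by rewrite exprS mulrCA; apply: ler_wpM2l.
have [l ul] := nrm_geometric q01 uq.
have Ul : U l.
  apply: (nrm_closedP U).1 => // e e0; have [n un] := ul _ e0.
  by exists (u n) => //; exact: un.
exists l => //; apply/eqP; rewrite -subr_eq0; apply/eqP/nrm_eq0P => e e0.
have [n un] := ul (e / 2) (divr_gt0 e0 (ltr0n _ 2)).
have lu := un n (leqnn n); have lu1 := un n.+1 (leqnSn n).
apply: (le_trans (nrmB _ (u n.+1) _)).
have := Tq _ _ Ul (Uu n); rewrite -[T (u n)]/(u n.+1) (nrmC (u n.+1)) => lT.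
have := nrm_ge0 (l - u n); nra.
Qed.

End Completeness.

Section StarAlgebraTheory.
Variables (R : realType) (A : starAlgType R).
Implicit Types a b c : A.

Lemma smul0l a : 0 ⋅ a = 0.
Proof. by rewrite -(scale0r (0 : A)) smulZl !scale0r. Qed.

Lemma smul0r a : a ⋅ 0 = 0.
Proof. by rewrite -(scale0r (0 : A)) smulZr !scale0r. Qed.

Lemma smulNl a b : (- a) ⋅ b = - (a ⋅ b).
Proof. by rewrite -(scaleN1r a) -(scaleN1r (_ ⋅ _)) smulZl. Qed.

Lemma smulNr a b : a ⋅ (- b) = - (a ⋅ b).
Proof. by rewrite -(scaleN1r b) -(scaleN1r (_ ⋅ _)) smulZr. Qed.

Lemma smulBl a b c : (a - b) ⋅ c = a ⋅ c - b ⋅ c.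
Proof. by rewrite smulDl smulNl. Qed.

Lemma smulBr a b c : a ⋅ (b - c) = a ⋅ b - a ⋅ c.
Proof. by rewrite smulDr smulNr. Qed.

Lemma smul_suml (I : Type) (r : seq I) (F : I -> A) a :
  (\sum_(i <- r) F i) ⋅ a = \sum_(i <- r) F i ⋅ a.
Proof. by elim/big_rec2: _ => [|i x y _ <-]; rewrite (smul0l, smulDl). Qed.

Lemma star0 : (0 : A)^*' = 0.
Proof. by rewrite -(scale0r (0 : A)) starZ rmorph0 !scale0r. Qed.

Lemma starN a : (- a)^*' = - a^*'.
Proof. by rewrite -(scaleN1r a) -(scaleN1r (star _)) starZ rmorphN rmorph1. Qed.

Lemma starB a b : (a - b)^*' = a^*' - b^*'.
Proof. by rewrite starD starN. Qed.

Lemma star1 : (sone : A)^*' = sone.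
Proof. by rewrite -[LHS]smul1r -[X in _ ⋅ X]starK -starM smul1r starK. Qed.

Definition sinverse a b := a ⋅ b = sone /\ b ⋅ a = sone.

Lemma sinverseM a a' b b' :
  sinverse a a' -> sinverse b b' -> sinverse (a ⋅ b) (b' ⋅ a').
Proof.
move=> [aa' a'a] [bb' b'b]; split; rewrite smulA.
  by rewrite -(smulA a) bb' smul1r.
by rewrite -(smulA b') a'a smul1r.
Qed.

End StarAlgebraTheory.

Section CStarAlgebraTheory.
Variables (R : realType) (A : cstarAlgType R).
Implicit Types a b c h : A.

Lemma nrmM a b : nrm (a ⋅ b) <= nrm a * nrm b.
Proof. by rewrite -lecR rmorphM/= -!nrmE cstar_normM. Qed.

Lemma nrm_cstar a : nrm (a^*' ⋅ a) = nrm a ^+ 2.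
Proof. by apply: (@complexI R); rewrite rmorphXn/= -!nrmE cstar_norm. Qed.

Lemma nrm_star a : nrm a^*' = nrm a.
Proof.
suff le b : nrm b <= nrm b^*' by apply/eqP; rewrite eq_le le -{2}(starK a) le.
have [->|b0] := eqVneq b 0; first by rewrite star0.
have b_gt0 : 0 < nrm b by rewrite lt_neqAle nrm_ge0 eq_sym nrm_eq0 b0.
by rewrite -(ler_pM2r b_gt0) -expr2 -nrm_cstar nrmM.
Qed.

(** The C*-identity gives [|a|^2 = |1|] and [|1|^2 = |1|], so [|1|] is 0 or 1; the value 0 is that
    of the zero algebra, hence an inequality. *)
Lemma nrm_unitary a : a^*' ⋅ a = sone -> nrm a <= 1.
Proof.
move=> aa; have sq1 b : nrm b ^+ 2 = nrm (sone : A) -> nrm b <= 1.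
  move=> bE; have := nrm_cstar (sone : A); rewrite star1 smul1l => E.
  have := nrm_ge0 (sone : A); have := nrm_ge0 b.
  have [e0|e0] := eqVneq (nrm (sone : A)) 0.
    rewrite e0 in bE; nra.
  have : nrm (sone : A) = 1.
    by apply: (mulfI e0); rewrite mulr1 -expr2.
  move=> e1; rewrite e1 in bE; nra.
by apply: sq1; rewrite -nrm_cstar aa.
Qed.

(** The fixed points of [y => 1 + a y] and of [y => 1 + y a] are a right and a left inverse of
    [1 - a], and therefore coincide. *)
Lemma neumann a : nrm a < 1 -> exists b, sinverse (sone - a) b.
Proof.
move=> a1; have a01 : 0 <= nrm a < 1 by rewrite nrm_ge0.
have [b _ bE] : exists2 b, setT b & sone + a ⋅ b = b.
  apply: (contraction_fixpoint (x0 := 0) closedT _ _ a01) => // x y _ _.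
  by rewrite opprD addrACA subrr add0r -smulBr nrmM.
have [c _ cE] : exists2 c, setT c & sone + c ⋅ a = c.
  apply: (contraction_fixpoint (x0 := 0) closedT _ _ a01) => // x y _ _.
  by rewrite opprD addrACA subrr add0r -smulBl mulrC nrmM.
have ab : (sone - a) ⋅ b = sone by rewrite smulBl smul1l -{1}bE addrK.
have ca : c ⋅ (sone - a) = sone by rewrite smulBr smul1r -{1}cE addrK.
exists b; split => //.
by have -> : b = c by rewrite -[b]smul1l -ca -smulA ab smul1r.
Qed.

(** With [p = 1 + i t h] and [m = p^*], which commute, the Cayley transform [c = m v] satisfies
    [c^* c = 1]. Both bounds follow from [2 v = 1 + c] and [2 i t h v = 1 - c]. *)
Lemma resolvent_skew_norm h (t : R) v : 0 <= t -> h^*' = h ->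
  sinverse (sone + (t *i) *: h) v -> nrm v <= 1 /\ t * nrm (h ⋅ v) <= 1.
Proof.
move=> t0 hh; set k := t *i; set p := sone + k *: h => -[pv vp].
have kc : k^* = - k by rewrite -[LHS]/(conjc k) /k; simpc.
pose m := sone - k *: h.
have pm : p^*' = m by rewrite starD star1 starZ hh kc scaleNr.
have mp : m^*' = p by rewrite -pm starK.
have comm : p ⋅ m = m ⋅ p.
  by rewrite smulDl smul1l smulBr smul1r smulBl smul1l smulDr smul1r opprD
    addrACA.
pose c := m ⋅ v.
have c1 : nrm c <= 1.
  apply: nrm_unitary;
    rewrite starM mp -smulA [p ⋅ _]smulA comm -smulA pv smul1r.
  by rewrite -pm -starM pv star1.
have cp : c + sone = 2%:C *: v.
  by rewrite -pv -smulDl addrACA addNr addr0 -mulr2n -scaler_nat smulZl smul1l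
    rmorph_nat.
have cm : sone - c = 2%:C *: (k *: (h ⋅ v)).
  rewrite -pv -smulBl /p /m opprB addrC addrA addrNK -mulr2n -scaler_nat.
  by rewrite !smulZl rmorph_nat.
have one1 : nrm (sone : A) <= 1 by apply: nrm_unitary; rewrite star1 smul1l.
split.
  have : nrm (2%:C *: v) <= 1 + 1.
    by rewrite -cp; apply: le_trans (nrmD _ _) _; exact: lerD.
  by rewrite nrmZr ger0_norm//; lra.
have : nrm (2%:C *: (k *: (h ⋅ v))) <= 1 + 1.
  by rewrite -cm; apply: le_trans (nrmD _ _) _; rewrite nrmN; exact: lerD.
by rewrite nrmZr nrmZi !ger0_norm//; lra.
Qed.

(* The norm bound above makes the size of the interval on which the Neumann
   series continues the resolvent independent of [t]. *)
Lemma resolvent_skew h (t : R) : 0 <= t -> h^*' = h ->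
  exists v, sinverse (sone + (t *i) *: h) v.
Proof.
move=> t0 hh; pose d := (nrm h + 1)^-1.
have h1 : 0 < nrm h + 1 by rewrite ltr_wpDl ?nrm_ge0.
have d0 : 0 < d by rewrite invr_gt0.
have step (s : R) : (exists v, sinverse (sone + (s *i) *: h) v) -> 0 <= s ->
    forall e, 0 <= e <= d -> exists v, sinverse (sone + ((s + e) *i) *: h) v.
  move=> [v vP] s0 e /andP[e0 ed].
  have [v1 _] := resolvent_skew_norm s0 hh vP.
  have [|w wP] := @neumann (- (e *i *: (h ⋅ v))).
    rewrite nrmN nrmZi ger0_norm//.
    have hv : nrm (h ⋅ v) <= nrm h.
      by apply: le_trans (nrmM _ _) _; have := nrm_ge0 h; nra.
    have dh : d * nrm h < 1 by rewrite mulrC ltr_pdivrMr// mul1r ltrDl.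
    have := nrm_ge0 h; nra.
  exists (v ⋅ w).
  (* As [v] inverts [1 + i s h], the new element is [1 + i e h v] times [1 + i s h]; the first
     factor has inverse [w] because [e |h v| <= d |h| < 1]. *)
  have -> : sone + (s + e) *i *: h =
      (sone - - (e *i *: (h ⋅ v))) ⋅ (sone + s *i *: h).
    case: vP => _ vp; rewrite opprK smulDl smul1l smulZl -(smulA h) vp smul1r.
    by rewrite -addrA -scalerDl; congr (_ + _ *: _); simpc.
  exact: sinverseM.
have all n s : 0 <= s <= d *+ n -> exists v, sinverse (sone + (s *i) *: h) v.
  elim: n s => [|n IH] s.
    rewrite mulr0n -eq_le => /eqP <-; exists sone.
    have -> : sone + 0 *i *: h = sone by rewrite (_ :
      0 *i = 0 :> R[i])// scale0r addr0.
    by split; rewrite smul1l.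
  rewrite mulrS => /andP[s0 sn]; have [sd|ds] := leP s d.
    have /step/(_ (lexx 0) s) : exists v, sinverse (sone + (0 *i) *: h) v.
      by apply: (IH 0); rewrite lexx mulrn_wge0// ltW.
    by rewrite add0r s0 sd; apply.
  rewrite -[s](subrK d); apply: step.
  - by apply: IH; rewrite subr_ge0 ltW// lerBlDl.
  - by rewrite subr_ge0 ltW.
  - by rewrite ltW/=.
apply: (all (Num.truncn (t / d)).+1 t); rewrite t0/=.
have : t / d < (Num.truncn (t / d)).+1%:R by rewrite truncnS_gt.
by rewrite ltr_pdivrMr// mulr_natl => /ltW.
Qed.

(** Both [b + i c] and [b - i c] are unitary and their sum is [2 b]. A norm is thus bounded by an
    algebraic identity, which star-morphisms transport. *)
Lemma nrm_circle b c : b^*' = b -> c^*' = c -> b ⋅ c = c ⋅ b ->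
  b ⋅ b + c ⋅ c = sone -> nrm b <= 1.
Proof.
move=> bb cc bc E; pose w (k : R[i]) := b + k *: c.
have ww (k : R[i]) : k * k = -1 -> k^* = - k -> nrm (w k) <= 1.
  move=> kk kc; apply: nrm_unitary.
  rewrite starD starZ bb cc kc scaleNr smulBl !smulDr !smulZl !smulZr bc
    scalerA.
  by rewrite kk scaleN1r opprB addrACA subrr addr0.
have ii : 'i%C * 'i%C = - 1 :> R[i] by rewrite -expr2 sqr_i.
have ic : 'i%C^* = - 'i%C :> R[i] by rewrite -[LHS]/(conjc 'i%C); simpc.
have w1 : nrm (w 'i%C) <= 1 by exact: ww.
have w2 : nrm (w (- 'i%C)) <= 1.
  by apply: ww; rewrite ?mulrNN// -ic conjCK ic opprK.
have E2 : w 'i%C + w (- 'i%C) = 2%:C *: b.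
  by rewrite /w scaleNr addrACA subrr addr0 -mulr2n -scaler_nat rmorph_nat.
have : nrm (2%:C *: b) <= 1 + 1.
  by rewrite -E2; apply: le_trans (nrmD _ _) _; exact: lerD.
by rewrite nrmZr ger0_norm//; lra.
Qed.

(** The square root is [s = 1 - y] with [y] a fixed point of [T y = (h^2 + y^2) / 2]: this equation
    says [(1 - y)^2 = 1 - h^2]. With [q = |h|^2 < 1], [T] preserves the ball of radius [q] and
    contracts it by the factor [q]. *)
Lemma selfadjoint_circle h : h^*' = h -> nrm h < 1 ->
  exists s, [/\ s^*' = s, s ⋅ h = h ⋅ s & h ⋅ h + s ⋅ s = sone].
Proof.
move=> hh h1; pose T y := 2^-1%:C *: (h ⋅ h + y ⋅ y); pose q := nrm h ^+ 2.
have q0 : 0 <= q by exact: sqr_ge0.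
have q1 : q < 1 by rewrite expr_lt1// nrm_ge0.
have hhq : nrm (h ⋅ h) <= q by rewrite -{1}hh nrm_cstar.
pose U : set A := [set y | [/\ nrm y <= q, y^*' = y & y ⋅ h = h ⋅ y]].
have cU : closed U.
  apply/nrm_closedP => y yU; split.
  - apply/ler_addgt0Pr => e /yU[b [bq _ _] ybe].
    by rewrite -[y](subrK b); apply: le_trans (nrmD _ _) _; lra.
  - apply/eqP; rewrite -subr_eq0; apply/eqP/nrm_eq0P => e e0.
    have [b [_ bs _] yb] := yU (e / 2) (divr_gt0 e0 (ltr0n _ 2)).
    apply: (le_trans (nrmB _ b _)); rewrite (nrmC b y).
    have -> : y^*' - b = (y - b)^*' by rewrite starB bs.
    by rewrite nrm_star; lra.
  - apply/eqP; rewrite -subr_eq0; apply/eqP/nrm_eq0P => e e0.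
    have hp : 0 < nrm h + 1 by rewrite ltr_wpDl ?nrm_ge0.
    pose d := e / 2 / (nrm h + 1).
    have d0 : 0 < d by rewrite !divr_gt0.
    have dE : d * (nrm h + 1) = e / 2 by rewrite divfK// gt_eqF.
    have [b [_ _ bh] yb] := yU d d0.
    apply: (le_trans (nrmB _ (b ⋅ h) _)); rewrite -smulBl bh -smulBr.
    have := nrmM (y - b) h; have := nrmM h (b - y); rewrite (nrmC b y).
    have := nrm_ge0 h; have := nrm_ge0 (y - b).
    move: dE yb d0; clearbody d; nra.
have half (x : A) : nrm (2^-1%:C *: x) = nrm x / 2.
  by rewrite nrmZr ger0_norm ?invr_ge0// mulrC.
have U0 : U 0 by split; rewrite ?nrm0 ?star0 ?smul0l ?smul0r//; exact: sqr_ge0.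
have UT y : U y -> U (T y).
  move=> [yq ys yh]; split.
  - rewrite half; have := nrmD (h ⋅ h) (y ⋅ y); have := nrmM y y.
    have := nrm_ge0 y; nra.
  - by rewrite starZ -[_^*]/(conjc _) conjc_real starD !starM hh ys.
  - rewrite smulZl smulZr smulDl smulDr; congr (_ *: (_ + _)).
      by rewrite smulA.
    by rewrite -smulA yh (smulA y h) yh -smulA.
have q01 : 0 <= q < 1 by rewrite q0.
have Tq x y : U x -> U y -> nrm (T x - T y) <= q * nrm (x - y).
  move=> [xq _ xh] [yq _ yh].
  rewrite -scalerBr half opprD addrACA subrr add0r.
  have -> : x ⋅ x - y ⋅ y = x ⋅ (x - y) + (x - y) ⋅ y.
    by rewrite smulBr smulBl addrA addrNK.
  have := nrmD (x ⋅ (x - y)) ((x - y) ⋅ y).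
  have := nrmM x (x - y); have := nrmM (x - y) y.
  have := nrm_ge0 (x - y); nra.
have [y [yq ys yh] yE] := contraction_fixpoint cU U0 UT q01 Tq.
exists (sone - y); split.
- by rewrite starB star1 ys.
- by rewrite smulBl smulBr smul1l smul1r yh.
have : 2%:C *: y = h ⋅ h + y ⋅ y.
  by rewrite -{1}yE /T scalerA -rmorphM divff// scale1r.
rewrite rmorph_nat scaler_nat mulr2n => E.
have -> : h ⋅ h = y + y - y ⋅ y by rewrite E addrK.
rewrite smulBl !smulBr !smul1l smul1r opprB addrACA addKr.
by rewrite [sone - y]addrC addrA addrK addrC addKr.
Qed.

End CStarAlgebraTheory.

Section StarMorphismTheory.
Variables (R : realType) (A B : starAlgType R) (f : A -> B).
Hypothesis fP : star_morphism f.

Lemma star_morphismD a b : f (a + b) = f a + f b.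
Proof. by have := star_morphism_linear fP 1 a b; rewrite !scale1r. Qed.

Lemma star_morphism0 : f 0 = 0.
Proof. by apply: (addrI (f 0)); rewrite -star_morphismD !addr0. Qed.

Lemma star_morphismZ k a : f (k *: a) = k *: f a.
Proof.
by have := star_morphism_linear fP k a 0; rewrite star_morphism0 !addr0.
Qed.

Lemma star_morphismB a b : f (a - b) = f a - f b.
Proof. by rewrite star_morphismD -scaleN1r star_morphismZ scaleN1r. Qed.

Lemma star_morphism_sum (I : Type) (r : seq I) (F : I -> A) :
  f (\sum_(i <- r) F i) = \sum_(i <- r) f (F i).
Proof.
by elim/big_rec2: _ => [|i x y _ <-]; rewrite (star_morphism0, star_morphismD).
Qed.

End StarMorphismTheory.

Lemma star_morphism_comp (R : realType) (A B C : starAlgType R)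
    (f : A -> B) (g : B -> C) :
  star_morphism f -> star_morphism g -> star_morphism (g \o f).
Proof.
move=> fP gP; split=> /=.
- by move=> k a b /=;
    rewrite !(star_morphismD fP, star_morphismZ fP) !(star_morphismD gP,
    star_morphismZ gP).
- by rewrite !star_morphism1.
- by move=> a b; rewrite (star_morphismM fP) (star_morphismM gP).
- by move=> a; rewrite (star_morphism_star fP) (star_morphism_star gP).
Qed.

(** For [h] self-adjoint with [|h| < 1], the relation [h^2 + s^2 = 1] is carried to [B], where it
    bounds [f h]. Scaling gives all self-adjoint elements, and the C*-identity applied to [a^* a]
    gives the rest. *)
Lemma star_morphism_nrm (R : realType) (A B : cstarAlgType R) (f : A -> B) :
  star_morphism f -> forall a, nrm (f a) <= nrm a.
Proof.
move=> fP; have [_ f1 fM fS] := fP.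
have sa h : h^*' = h -> nrm h < 1 -> nrm (f h) <= 1.
  move=> hh /(selfadjoint_circle hh)[s [ss sh hs]].
  apply: (nrm_circle (c := f s)); rewrite -?fS -?fM ?hh ?ss ?sh//.
  by rewrite -(star_morphismD fP) hs.
have sa_le h : h^*' = h -> nrm (f h) <= nrm h.
  move=> hh; apply/ler_addgt0Pr => e e0.
  have he : 0 < nrm h + e by rewrite ltr_wpDl ?nrm_ge0.
  have := sa ((nrm h + e)^-1%:C *: h).
  rewrite starZ -[_^*]/(conjc _) conjc_real hh (star_morphismZ fP) !nrmZr
    gtr0_norm ?invr_gt0//.
  rewrite mulrC ltr_pdivrMr// mul1r ltrDl => /(_ erefl e0).
  by rewrite mulrC ler_pdivrMr// mul1r.
move=> a; rewrite -(@ler_pXn2r _ 2)// ?nnegrE ?nrm_ge0//.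
by rewrite -!nrm_cstar -fS -fM; apply: sa_le; rewrite starM starK.
Qed.

(** * Quotients of C*-algebras *)

Section IdealTheory.
Variables (R : realType) (A : cstarAlgType R) (K : set A).
Hypothesis cK : closed_ideal K.
Implicit Types a b k : A.

Lemma idealZ (c : R[i]) a : K a -> K (c *: a).
Proof. by move=> Ka; rewrite -[a]smul1l -smulZl; exact: idealMl. Qed.

Lemma idealN a : K a -> K (- a).
Proof. by rewrite -scaleN1r; exact: idealZ. Qed.

Lemma ideal_subC a b : K (a - b) -> K (b - a).
Proof. by move=> /idealN; rewrite opprB. Qed.

Lemma ideal_sub_trans a b c : K (a - b) -> K (b - c) -> K (a - c).
Proof. by move=> ab bc; rewrite -(subrK b a) -addrA; exact: idealD. Qed.

Lemma ideal_sum (I : Type) (r : seq I) (F : I -> A) :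
  (forall i, K (F i)) -> K (\sum_(i <- r) F i).
Proof.
by move=> KF; elim/big_ind: _ => //; [exact: ideal0|exact: idealD].
Qed.

Hypothesis sK : forall a, K a -> K a^*'.

(* With [h = k^* k] and [v = (1 + i t h)^-1], take [u = v^* v]: then
   [|k u|^2 = |u h u|] is at most [|h v| <= 1 / t]. *)
Lemma ideal_approximate_unit k (e : R) : K k -> 0 < e ->
  exists u, [/\ u^*' = u, nrm u <= 1, K (sone - u) & nrm (k ⋅ u) <= e].
Proof.
move=> Kk e0; pose h := k^*' ⋅ k; pose t := (e ^+ 2)^-1.
have e20 : 0 < e ^+ 2 by rewrite exprn_gt0.
have t0 : 0 < t by rewrite invr_gt0.
have hh : h^*' = h by rewrite starM starK.
have Kh : K h by exact: idealMl.
have [v vP] := resolvent_skew (ltW t0) hh.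
have [v1 hv1] := resolvent_skew_norm (ltW t0) hh vP.
case: vP => pv vp.
have it0 : t *i != 0 :> R[i] by rewrite eq_complex /= eqxx gt_eqF.
have vh : v ⋅ h = h ⋅ v.
  have : v ⋅ (sone + t *i *: h) = (sone + t *i *: h) ⋅ v by rewrite pv vp.
  rewrite smulDr smulDl smul1r smul1l => /addrI.
  by rewrite smulZr smulZl => /(scalerI it0).
(* From [v (1 + i t h) = 1], the difference [1 - v] is [i t v h]. *)
have K1v : K (sone - v).
  rewrite -{1}vp smulDr smul1r addrAC subrr add0r smulZr; apply: idealZ.
  exact: idealMl.
have vs1 : nrm v^*' <= 1 by rewrite nrm_star.
have uu : (v^*' ⋅ v)^*' = v^*' ⋅ v by rewrite starM starK.
exists (v^*' ⋅ v); split => //.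
- by apply: le_trans (nrmM _ _) _; rewrite -[1]mulr1 ler_pM ?nrm_ge0.
- apply: (@ideal_sub_trans _ v^*').
    by rewrite -[X in K (X - _)]star1 -starB; exact: sK.
  by rewrite -{1}[v^*']smul1r -smulBr; exact: idealMl.
- rewrite -(@ler_pXn2r _ 2)// ?nnegrE ?nrm_ge0 ?(ltW e0)// -nrm_cstar starM uu.
  have -> : v^*' ⋅ v ⋅ k^*' ⋅ (k ⋅ (v^*' ⋅ v)) = v^*' ⋅ (h ⋅ v) ⋅ (v^*' ⋅ v).
    by rewrite -vh !smulA.
  have hve : nrm (h ⋅ v) <= e ^+ 2.
    by move: hv1; rewrite mulrC ler_pdivrMr// mul1r.
  have vv1 : nrm (v^*' ⋅ v) <= 1.
    by apply: le_trans (nrmM _ _) _; rewrite -[1]mulr1 ler_pM ?nrm_ge0.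
  apply: (le_trans (nrmM _ _)); have := nrmM v^*' (h ⋅ v).
  have := nrm_ge0 (h ⋅ v); have := nrm_ge0 (v^*' ⋅ (h ⋅ v)).
  have := nrm_ge0 v^*'; have := nrm_ge0 (v^*' ⋅ v); nra.
Qed.

End IdealTheory.

Section Quotient.
Variables (R : realType) (A : cstarAlgType R) (K : set A).
Hypothesis cK : closed_ideal K.
Hypothesis sK : forall a, K a -> K a^*'.
Implicit Types a b c : A.

Definition quot_repr a : A := get [set b | K (a - b)].

Lemma quot_reprP a : K (a - quot_repr a).
Proof.
by apply: (@getPex _ [set b | K (a - b)]); exists a; rewrite /= subrr;
  exact: ideal0.
Qed.

Lemma quot_repr_eq a b : K (a - b) -> quot_repr a = quot_repr b.
Proof.
move=> ab; congr get; apply/seteqP; split=> c /=;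
  apply: (ideal_sub_trans cK) => //.
exact: (ideal_subC cK).
Qed.

(* The quotient is carried by canonical representatives of the cosets. *)
Definition cstar_quot of closed_ideal K & (forall a, K a -> K a^*') : Type :=
  {a : A | quot_repr a == a}.
Local Notation Q := (cstar_quot cK sK).

Fact quot_proj_subproof a : quot_repr (quot_repr a) == quot_repr a.
Proof. by apply/eqP/quot_repr_eq/(ideal_subC cK)/quot_reprP. Qed.

Definition quot_proj a : Q := exist _ (quot_repr a) (quot_proj_subproof a).
Local Notation pi := quot_proj.

Lemma quot_projP a b : pi a = pi b <-> K (a - b).
Proof.
split=> [[ab]|ab]; last by apply: val_inj; exact: quot_repr_eq.
apply: (ideal_sub_trans cK (quot_reprP a)); rewrite ab.
exact/(ideal_subC cK)/quot_reprP.
Qed.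

Lemma quot_surj (x : Q) : exists a, x = pi a.
Proof. by exists (sval x); apply: val_inj; rewrite /= (eqP (svalP x)). Qed.

HB.instance Definition _ := Choice.on Q.

Definition quot_add (x y : Q) : Q := pi (sval x + sval y).
Definition quot_opp (x : Q) : Q := pi (- sval x).
Definition quot_scale (l : R[i]) (x : Q) : Q := pi (l *: sval x).
Definition quot_mul (x y : Q) : Q := pi (sval x ⋅ sval y).
Definition quot_star (x : Q) : Q := pi (sval x)^*'.

Lemma quot_addE a b : quot_add (pi a) (pi b) = pi (a + b).
Proof.
apply/quot_projP/(ideal_subC cK); rewrite opprD addrACA.
by apply: idealD => //; exact: quot_reprP.
Qed.

Lemma quot_oppE a : quot_opp (pi a) = pi (- a).
Proof. by apply/quot_projP; rewrite opprK addrC; exact: quot_reprP. Qed.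

Lemma quot_scaleE l a : quot_scale l (pi a) = pi (l *: a).
Proof.
apply/quot_projP/(ideal_subC cK); rewrite -scalerBr; apply: idealZ => //.
exact: quot_reprP.
Qed.

Lemma quot_mulE a b : quot_mul (pi a) (pi b) = pi (a ⋅ b).
Proof.
apply/quot_projP/(ideal_subC cK).
apply: (@ideal_sub_trans _ _ _ cK _ (quot_repr a ⋅ b)).
  by rewrite -smulBl; apply: (Defs.idealMr cK); exact: quot_reprP.
by rewrite /= -smulBr; apply: (idealMl cK); exact: quot_reprP.
Qed.

Lemma quot_starE a : quot_star (pi a) = pi a^*'.
Proof.
apply/quot_projP/(ideal_subC cK); rewrite -starB; apply: sK.
exact: quot_reprP.
Qed.

Let quotE := (quot_addE, quot_oppE, quot_scaleE, quot_mulE, quot_starE).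
Local Ltac lift x := have [? ->] := quot_surj x.

Fact quot_addA : associative quot_add.
Proof. by move=> x y z; lift x; lift y; lift z; rewrite !quotE addrA. Qed.
Fact quot_addC : commutative quot_add.
Proof. by move=> x y; lift x; lift y; rewrite !quotE addrC. Qed.
Fact quot_add0 : left_id (pi 0) quot_add.
Proof. by move=> x; lift x; rewrite !quotE add0r. Qed.
Fact quot_addN : left_inverse (pi 0) quot_opp quot_add.
Proof. by move=> x; lift x; rewrite !quotE addNr. Qed.

HB.instance Definition _ :=
  GRing.isZmodule.Build Q quot_addA quot_addC quot_add0 quot_addN.

Fact quot_scaleA (k l : R[i]) (x : Q) :
  quot_scale k (quot_scale l x) = quot_scale (k * l) x.
Proof. by lift x; rewrite !quotE scalerA. Qed.
Fact quot_scale1 : left_id 1 quot_scale.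
Proof. by move=> x; lift x; rewrite !quotE scale1r. Qed.
Fact quot_scaleDr : right_distributive quot_scale +%R.
Proof.
move=> l x y; lift x; lift y.
by rewrite -[_ + _]/(quot_add _ _) -[RHS]/(quot_add _ _) !quotE scalerDr.
Qed.
Fact quot_scaleDl (x : Q) : {morph quot_scale^~ x : k l / k + l}.
Proof.
move=> k l; lift x.
by rewrite -[RHS]/(quot_add _ _) !quotE scalerDl.
Qed.

HB.instance Definition _ := GRing.Zmodule_isLmodule.Build R[i] Q
  quot_scaleA quot_scale1 quot_scaleDr quot_scaleDl.

Lemma quot_projD a b : pi (a + b) = pi a + pi b.
Proof. by rewrite -quot_addE. Qed.
Lemma quot_projN a : pi (- a) = - pi a.
Proof. by rewrite -quot_oppE. Qed.
Lemma quot_projB a b : pi (a - b) = pi a - pi b.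
Proof. by rewrite quot_projD quot_projN. Qed.
Lemma quot_projZ l a : pi (l *: a) = l *: pi a.
Proof. by rewrite -quot_scaleE. Qed.
Lemma quot_proj0 a : pi a = 0 <-> K a.
Proof. by rewrite -[X in K X]subr0 -quot_projP. Qed.

Definition quot_nrm (x : Q) : R := inf [set nrm a | a in [set a | pi a = x]].

Let has_inf_nrm x : has_inf [set nrm a | a in [set a | pi a = x]].
Proof.
have [a ->] := quot_surj x; split; first by exists (nrm a), a.
by exists 0 => _ [b _ <-]; exact: nrm_ge0.
Qed.

Lemma quot_nrm_le a : quot_nrm (pi a) <= nrm a.
Proof. by apply: ge_inf; [case: (has_inf_nrm (pi a))|exists a]. Qed.

Lemma quot_nrm_lift x (e : R) : 0 < e ->
  exists2 a, pi a = x & nrm a < quot_nrm x + e.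
Proof.
by move=> e0; have [_ [a ax <-] ae] := inf_adherent e0 (has_inf_nrm x);
  exists a.
Qed.

Lemma quot_nrm_ge0 x : 0 <= quot_nrm x.
Proof.
by apply: lb_le_inf => [|_ [b _ <-]]; [case: (has_inf_nrm x)|exact: nrm_ge0].
Qed.

Definition quot_norm (x : Q) : R[i] := (quot_nrm x)%:C.

Fact quot_normD x y : quot_norm (x + y) <= quot_norm x + quot_norm y.
Proof.
rewrite -rmorphD lecR; apply/ler_addgt0Pr => e e0.
have [a <- ax] := quot_nrm_lift x (divr_gt0 e0 (ltr0n _ 2)).
have [b <- bx] := quot_nrm_lift y (divr_gt0 e0 (ltr0n _ 2)).
by rewrite -quot_projD; have := quot_nrm_le (a + b); have := nrmD a b; lra.
Qed.

Fact quot_normZ l x : quot_norm (l *: x) = `|l| * quot_norm x.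
Proof.
rewrite normc_def -rmorphM; congr _%:C; set m := Num.sqrt _.
have nZ k (a : A) :
  nrm (k *: a) = Num.sqrt (complex.Re k ^+ 2 + complex.Im k ^+ 2) * nrm a.
  by rewrite nrmZ /nrm normc_def.
have le k y : quot_nrm (k *: y) <=
    Num.sqrt (complex.Re k ^+ 2 + complex.Im k ^+ 2) * quot_nrm y.
  set s := Num.sqrt _; have s0 : 0 <= s by exact: sqrtr_ge0.
  apply/ler_addgt0Pr => e e0.
  have s1 : 0 < s + 1 by rewrite ltr_wpDl.
  have [a ay an] := quot_nrm_lift y (divr_gt0 e0 s1).
  rewrite -{1}ay -quot_projZ; apply: (le_trans (quot_nrm_le _)).
  rewrite nZ -/s; apply: (@le_trans _ _ (s * (quot_nrm y + e / (s + 1)))).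
    by apply: ler_wpM2l => //; exact: ltW.
  rewrite mulrDr lerD2l mulrCA ler_piMr ?(ltW e0)//.
  by rewrite ler_pdivrMr// mul1r lerDl.
have [l0|l0] := eqVneq l 0.
  rewrite /m l0 /= !expr0n addr0 sqrtr0 mul0r scale0r.
  apply/eqP; rewrite eq_le quot_nrm_ge0 andbT -(nrm0 A).
  exact: quot_nrm_le.
apply/eqP; rewrite eq_le le/=.
have ml : m%:C = `|l| by rewrite normc_def.
have m0 : 0 < m by rewrite -ltcR ml normr_gt0.
(* The reverse inequality is the one just proved, for the scalar [l^-1]. *)
have := le l^-1 (l *: x); rewrite scalerA mulVf// scale1r.
have -> : Num.sqrt (complex.Re l^-1 ^+ 2 + complex.Im l^-1 ^+ 2) = m^-1.
  by apply: (@complexI R); rewrite -normc_def normfV -ml fmorphV.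
by rewrite mulrC ler_pdivlMr// mulrC.
Qed.

Fact quot_norm_eq0 x : quot_norm x = 0 -> x = 0.
Proof.
move=> /(@complexI R _ 0) x0; have [a ax] := quot_surj x; rewrite ax.
apply/quot_proj0; apply: ((nrm_closedP K).1 (ideal_closed cK)) => e e0.
have [b bx be] := quot_nrm_lift x e0.
exists (a - b); first by apply/quot_projP; rewrite -ax.
by rewrite opprB addrC subrK -[e]add0r -x0.
Qed.

HB.instance Definition _ := Lmodule_isNormed.Build R[i] Q
  quot_normD quot_normZ quot_norm_eq0.

Lemma quot_nrmE (x : Q) : nrm x = quot_nrm x.
Proof. by []. Qed.

(** The filter is traced by points [x n] whose balls of radius [2^-n] belong to it. Their
    consecutive differences lift to elements [c n] of geometrically small norm; the partial sums of
    these converge in [A], and the limit is projected back. *)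
Lemma quot_complete (F : set_system Q) : ProperFilter F -> cauchy F -> cvg F.
Proof.
move=> FF /cauchyP Fc.
pose r n : R := 2^-1 ^+ n; have r0 n : 0 < r n by rewrite exprn_gt0// invr_gt0.
have rS n : r n.+1 = r n / 2 by rewrite /r exprSr.
have [x xF] : {x : nat -> Q & forall n, F (ball (x n) (r n)%:C)}.
  by apply: (@choice _ _ (fun n x => F (ball x (r n)%:C))) => n; apply: Fc;
    rewrite ltcR.
have xx n : nrm (x n.+1 - x n) < 2 * r n.
  have [y [/nrm_ball xy /nrm_ball xy']] := filter_ex (filterI (xF n) (xF n.+1)).
  have := nrmB (x n.+1) y (x n); rewrite (nrmC y) rS in xy' *.
  by have := r0 n; lra.
have [c cP] : {c : nat ->
  A & forall n, pi (c n) = x n.+1 - x n /\ nrm (c n) < 3 * r n}.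
  apply: (@choice _ _ (fun n a => pi a = x n.+1 - x n /\ nrm a < 3 * r n)) => n.
  have [a ax an] := quot_nrm_lift (x n.+1 - x n) (r0 n).
  by exists a; split => //; have := xx n; rewrite quot_nrmE; lra.
have [b0 b0x] := quot_surj (x 0%N).
pose b n := b0 + \sum_(i < n) c i.
have bS n : b n.+1 = b n + c n by rewrite /b big_ord_recr addrA.
have bx n : pi (b n) = x n.
  elim: n => [|n IH]; first by rewrite /b big_ord0 addr0.
  by rewrite bS quot_projD IH (cP n).1 addrC subrK.
have q01 : 0 <= (2^-1 : R) < 1 by rewrite invr_ge0 ler0n invf_lt1// ltr1n.
have [|l bl] := @nrm_geometric R A b 3 _ q01.
  by move=> n; rewrite bS opprD addNKr nrmN ltW// (cP n).2.
apply/cvg_ex; exists (pi l) => B /nrm_nbhs[e e0 sB].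
have [n bn] := bl (e / 2) (divr_gt0 e0 (ltr0n _ 2)).
have [m] := geometric_small ler01 q01 (divr_gt0 e0 (ltr0n _ 2)).
rewrite mul1r => rm.
have [k [rk bk]] : exists k, r k < e / 2 /\ nrm (l - b k) < e / 2.
  exists (maxn m n); split; last by apply: bn; exact: leq_maxr.
  apply: le_lt_trans rm; apply: ler_wiXn2l; rewrite ?leq_maxl//;
    case/andP: q01 => //.
  by move=> _ /ltW.
apply: filterS (xF k) => y /nrm_ball yk; apply: sB.
have := nrmB (pi l) (x k) y; rewrite -{1}bx -quot_projB.
by have := quot_nrm_le (l - b k); rewrite quot_nrmE; lra.
Qed.

HB.instance Definition _ := Uniform_isComplete.Build Q quot_complete.

Fact quot_mulA x y z : quot_mul x (quot_mul y z) = quot_mul (quot_mul x y) z.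
Proof. by lift x; lift y; lift z; rewrite !quot_mulE smulA. Qed.
Fact quot_mul1l x : quot_mul (pi sone) x = x.
Proof. by lift x; rewrite quot_mulE smul1l. Qed.
Fact quot_mul1r x : quot_mul x (pi sone) = x.
Proof. by lift x; rewrite quot_mulE smul1r. Qed.
Fact quot_mulDl x y z : quot_mul (x + y) z = quot_mul x z + quot_mul y z.
Proof. by lift x; lift y; lift z;
  rewrite -quot_projD !quot_mulE -quot_projD smulDl. Qed.
Fact quot_mulDr x y z : quot_mul x (y + z) = quot_mul x y + quot_mul x z.
Proof. by lift x; lift y; lift z;
  rewrite -quot_projD !quot_mulE -quot_projD smulDr. Qed.
Fact quot_mulZl (l : R[i]) x y : quot_mul (l *: x) y = l *: quot_mul x y.
Proof. by lift x; lift y;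
  rewrite -quot_projZ !quot_mulE -quot_projZ smulZl. Qed.
Fact quot_mulZr (l : R[i]) x y : quot_mul x (l *: y) = l *: quot_mul x y.
Proof. by lift x; lift y;
  rewrite -quot_projZ !quot_mulE -quot_projZ smulZr. Qed.
Fact quot_starK x : quot_star (quot_star x) = x.
Proof. by lift x; rewrite !quot_starE starK. Qed.
Fact quot_starD x y : quot_star (x + y) = quot_star x + quot_star y.
Proof. by lift x; lift y;
  rewrite -quot_projD !quot_starE -quot_projD starD. Qed.
Fact quot_starZ (l : R[i]) x : quot_star (l *: x) = l^* *: quot_star x.
Proof. by lift x; rewrite -quot_projZ !quot_starE -quot_projZ starZ. Qed.
Fact quot_starM x y :
  quot_star (quot_mul x y) = quot_mul (quot_star y) (quot_star x).
Proof. by lift x; lift y; rewrite !(quot_mulE, quot_starE) starM. Qed.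

HB.instance Definition _ := isStarAlgebra.Build R Q
  quot_mulA quot_mul1l quot_mul1r quot_mulDl quot_mulDr quot_mulZl quot_mulZr
  quot_starK quot_starD quot_starZ quot_starM.

Lemma quot_projM a b : pi (a ⋅ b) = pi a ⋅ pi b.
Proof. by rewrite -quot_mulE. Qed.
Lemma quot_proj_star a : pi a^*' = (pi a)^*'.
Proof. by rewrite -quot_starE. Qed.

Fact quot_normM (x y : Q) : `|x ⋅ y| <= `|x| * `|y|.
Proof.
rewrite !nrmE -rmorphM lecR; apply/ler_addgt0Pr => e e0.
(* For [d <= 1], the product of [|x| + d] and [|y| + d] exceeds [|x| |y|] by at most [d m]. *)
pose m := nrm x + nrm y + 1.
have m0 : 0 < m by have := nrm_ge0 x; have := nrm_ge0 y; rewrite /m; lra.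
pose d := Num.min 1 (e / m).
have d0 : 0 < d by rewrite lt_min ltr01 divr_gt0.
have d1 : d <= 1 by rewrite ge_min lexx.
have dm : d * m <= e by rewrite -ler_pdivlMr// ge_min lexx orbT.
have [a ax an] := quot_nrm_lift x d0; have [b bx bn] := quot_nrm_lift y d0.
rewrite -ax -bx -quot_projM; apply: (le_trans (quot_nrm_le _)).
apply: (le_trans (nrmM _ _)).
rewrite ax bx; rewrite -!quot_nrmE in an bn.
apply: (le_trans (ler_pM (nrm_ge0 _) (nrm_ge0 _) (ltW an) (ltW bn))).
have := nrm_ge0 x; have := nrm_ge0 y; move: d0 d1 dm; rewrite /m; clearbody d;
  nra.
Qed.

Lemma quot_proj_nrm a : nrm (pi a) <= nrm a.
Proof. exact: quot_nrm_le. Qed.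

(** For the lower bound on [x^* x], take a lift [b] of it of almost minimal norm and a lift [a] of
    [x]. As [b - a^* a] is in [K], some [u] congruent to 1 makes its product with [u] small; then
    [a u] still lifts [x], and [|a u|^2 = |u a^* a u|] is at most [|b|] up to [e]. *)
Fact quot_cstar (x : Q) : `|x^*' ⋅ x| = `|x| ^+ 2.
Proof.
rewrite !nrmE -rmorphXn; congr _%:C; apply/eqP; rewrite eq_le; apply/andP;
  split.
  have xs : nrm x^*' <= nrm x.
    apply/ler_addgt0Pr => e e0; have [a <- an] := quot_nrm_lift x e0.
    rewrite -quot_proj_star; apply: (le_trans (quot_nrm_le _)).
    by rewrite nrm_star ltW.
  have := quot_normM x^*' x; rewrite !nrmE -rmorphM lecR.
  by have := nrm_ge0 x; have := nrm_ge0 x^*'; nra.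
have [a ax] := quot_surj x.
apply/ler_addgt0Pr => e e0.
have [b bx bn] := quot_nrm_lift (x^*' ⋅ x) (divr_gt0 e0 (ltr0n _ 2)).
have Kk : K (b - a^*' ⋅ a).
  by apply/quot_projP; rewrite bx ax quot_projM quot_proj_star.
have [u [us u1 Ku ku]] :=
  ideal_approximate_unit cK sK Kk (divr_gt0 e0 (ltr0n _ 2)).
have xE : x = pi (a ⋅ u).
  by rewrite ax; apply/quot_projP; rewrite -{1}[a]smul1r -smulBr;
    exact: (idealMl cK).
have xn : nrm x <= nrm (a ⋅ u) by rewrite xE; exact: quot_proj_nrm.
rewrite -quot_nrmE in bn.
have E : a^*' ⋅ a ⋅ u = b ⋅ u - (b - a^*' ⋅ a) ⋅ u.
  by rewrite -smulBl opprB addrC subrK.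
have : nrm (a ⋅ u) ^+ 2 <= nrm (x^*' ⋅ x) + e.
  rewrite -nrm_cstar starM us -smulA (smulA _ a) E.
  apply: (le_trans (nrmM _ _)).
  have := nrmD (b ⋅ u) (- ((b - a^*' ⋅ a) ⋅ u)); rewrite nrmN.
  have := nrmM b u; have := nrm_ge0 u; have := nrm_ge0 b.
  by have := nrm_ge0 (b ⋅ u - (b - a^*' ⋅ a) ⋅ u); nra.
by apply: le_trans; rewrite ler_pXn2r ?nnegrE ?nrm_ge0.
Qed.

HB.instance Definition _ := isCStarAlgebra.Build R Q quot_normM quot_cstar.

End Quotient.

(** * The opposite C*-algebra and the complex numbers *)

(** An alias that can carry the reversed product beside the original one. Antimorphisms become
    star-morphisms into it, so that the universal property of the spheres and contractivity apply to
    them. *)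
Definition opposite_alg (T : Type) : Type := T.

Section Opposite.
Variables (R : realType) (A : cstarAlgType R).
Local Notation Aop := (opposite_alg A).

HB.instance Definition _ := CompleteNormedModule.copy Aop A.

Definition opp_mul (a b : Aop) : Aop := (b : A) ⋅ (a : A).
Definition opp_star (a : Aop) : Aop := (a : A)^*'.

Fact opp_mulA a b c : opp_mul a (opp_mul b c) = opp_mul (opp_mul a b) c.
Proof. by rewrite /opp_mul smulA. Qed.
Fact opp_mul1l a : opp_mul sone a = a.
Proof. exact: smul1r. Qed.
Fact opp_mul1r a : opp_mul a sone = a.
Proof. exact: smul1l. Qed.
Fact opp_mulDl a b c : opp_mul (a + b) c = opp_mul a c + opp_mul b c.
Proof. exact: smulDr. Qed.
Fact opp_mulDr a b c : opp_mul a (b + c) = opp_mul a b + opp_mul a c.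
Proof. exact: smulDl. Qed.
Fact opp_mulZl (k : R[i]) a b : opp_mul (k *: a) b = k *: opp_mul a b.
Proof. exact: smulZr. Qed.
Fact opp_mulZr (k : R[i]) a b : opp_mul a (k *: b) = k *: opp_mul a b.
Proof. exact: smulZl. Qed.
Fact opp_starK a : opp_star (opp_star a) = a.
Proof. exact: starK. Qed.
Fact opp_starD a b : opp_star (a + b) = opp_star a + opp_star b.
Proof. exact: starD. Qed.
Fact opp_starZ (k : R[i]) a : opp_star (k *: a) = k^* *: opp_star a.
Proof. exact: starZ. Qed.
Fact opp_starM a b : opp_star (opp_mul a b) = opp_mul (opp_star b) (opp_star a).
Proof. exact: starM. Qed.

HB.instance Definition _ := isStarAlgebra.Build R Aop
  opp_mulA opp_mul1l opp_mul1r opp_mulDl opp_mulDr opp_mulZl opp_mulZr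
  opp_starK opp_starD opp_starZ opp_starM.

Fact opp_normM (a b : Aop) : `|a ⋅ b| <= `|a| * `|b|.
Proof. by rewrite mulrC; exact: (cstar_normM (b : A) (a : A)). Qed.

Fact opp_cstar (a : Aop) : `|a^*' ⋅ a| = `|a| ^+ 2.
Proof.
have := nrm_cstar ((a : A)^*'); rewrite starK nrm_star => E.
rewrite [LHS](nrmE ((a : A) ⋅ (a : A)^*')) E rmorphXn.
by rewrite [in RHS](nrmE (a : A)).
Qed.

HB.instance Definition _ := isCStarAlgebra.Build R Aop opp_normM opp_cstar.

End Opposite.

Section ComplexNumbers.
Variable R : realType.
Implicit Types z w : R[i].

Lemma nrmcE z : nrm (z :
  R[i]^o) = Num.sqrt (complex.Re z ^+ 2 + complex.Im z ^+ 2).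
Proof. by rewrite /nrm normc_def. Qed.

Lemma nrm_Re z : `|complex.Re z| <= nrm z.
Proof. by rewrite nrmcE -sqrtr_sqr ler_wsqrtr// lerDl sqr_ge0. Qed.

Lemma nrm_Im z : `|complex.Im z| <= nrm z.
Proof. by rewrite nrmcE -sqrtr_sqr ler_wsqrtr// lerDr sqr_ge0. Qed.

Lemma nrm_ReIm z : nrm z <= `|complex.Re z| + `|complex.Im z|.
Proof.
rewrite nrmcE -[leRHS]ger0_norm ?addr_ge0// -sqrtr_sqr ler_wsqrtr//.
rewrite sqrrD !real_normK ?num_real// -subr_ge0.
have : 0 <= `|complex.Re z| * `|complex.Im z| by rewrite mulr_ge0.
lra.
Qed.

(** Makes [R[i]] a C*-algebra, the target of the characters attached to points of the classical
    sphere. Completeness is inherited from [R] through real and imaginary parts. *)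
Lemma complex_complete (F : set_system R[i]) :
  ProperFilter F -> cauchy F -> cvg F.
Proof.
move=> FF /cauchyP Fc.
have part (f : R[i] -> R) : (forall z w, `|f z - f w| <= nrm (z - w)) ->
    exists a, forall e, 0 < e -> F [set z | `|a - f z| < e].
  move=> fle; have : cauchy_ex (f @ F).
    move=> e e0; have [|z Fz] := Fc e%:C; first by rewrite ltcR.
    exists (f z); suff : F (f @^-1` ball (f z) e) by [].
    apply: filterS Fz => w /nrm_ball zw.
    by rewrite /= -ball_normE /=; exact: le_lt_trans (fle _ _) zw.
  move=> /cauchy_exP /cauchy_cvg /cvg_ex[a fa]; exists a => e e0.
  by move/cvgrPdist_lt : fa => /(_ e e0).
have [|a Fa] := part (@complex.Re R).
  by move=> z w; apply: le_trans (nrm_Re _); rewrite raddfB.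
have [|b Fb] := part (@complex.Im R).
  by move=> z w; apply: le_trans (nrm_Im _); rewrite raddfB.
apply/cvg_ex; exists (a +i* b) => B /nrm_nbhs[e e0 sB].
have e20 := divr_gt0 e0 (ltr0n _ 2).
apply: filterS (filterI (Fa _ e20) (Fb _ e20)) => z [/= az bz]; apply: sB.
have := nrm_ReIm (a +i* b - z); rewrite !raddfB /= => zn.
apply: (le_lt_trans zn); lra.
Qed.

HB.instance Definition _ := Uniform_isComplete.Build R[i] complex_complete.

Fact complex_starM z w : (z * w)^* = w^* * z^*.
Proof. by rewrite rmorphM mulrC. Qed.

HB.instance Definition _ := isStarAlgebra.Build R R[i]
  (@mulrA R[i]) (@mul1r R[i]) (@mulr1 R[i]) (@mulrDl R[i]) (@mulrDr R[i])
  (fun k z w => esym (mulrA k z w)) (fun k z w => mulrCA z k w)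
  (@conjCK R[i]) (rmorphD Num.conj) (fun k z =>
    rmorphM Num.conj k z) complex_starM.

Fact complex_normM z w : `|z ⋅ w| <= `|z| * `|w|.
Proof. by rewrite -normrM. Qed.

Fact complex_cstar z : `|z^*' ⋅ z| = `|z| ^+ 2.
Proof. by rewrite normrM norm_conjC expr2. Qed.

HB.instance Definition _ :=
  isCStarAlgebra.Build R R[i] complex_normM complex_cstar.

End ComplexNumbers.

(** * Star-morphisms on algebras of continuous functions *)

Section RealParts.
Variables (R : realType) (K : topologicalType).
Implicit Types (f : cfun R K) (u : K -> R).

Lemma realC_continuous u : continuous u -> continuous (fun x =>
  (u x)%:C : R[i]).
Proof.
move=> cu x B /nrm_nbhs[e e0 sB]; have := cu x.
move=> /cvgrPdist_lt /(_ e e0); apply: filterS => y /= xy; apply: sB.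
have := nrm_ReIm ((u x)%:C - (u y)%:C).
rewrite !raddfB /= subrr normr0 addr0 => h; exact: le_lt_trans h xy.

Qed.

Lemma cvg_complex_part (p : R[i] ->
  R) (T : Type) (F : set_system T) (g : T -> R[i]) l :
  Filter F -> (forall z w, `|p z - p w| <= nrm (z - w)) ->
  g @ F --> l -> p \o g @ F --> p l.
Proof.
move=> FF pB gl; apply/cvgrPdist_lt => e e0.
have lN : nbhs l [set w | nrm (l - w) < e] by apply/nrm_nbhs; exists e.
have : F (g @^-1` [set w | nrm (l - w) < e]) by exact: gl lN.
by apply: filterS => y /= gy; exact: le_lt_trans (pB _ _) gy.
Qed.

Lemma ReB_le (z w : R[i]) : `|complex.Re z - complex.Re w| <= nrm (z - w).
Proof. by rewrite -raddfB nrm_Re. Qed.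

Lemma ImB_le (z w : R[i]) : `|complex.Im z - complex.Im w| <= nrm (z - w).
Proof. by rewrite -raddfB nrm_Im. Qed.

Lemma cfun_Re_continuous f : continuous (fun x => complex.Re (f x)).
Proof.
by move=> x; exact: (cvg_complex_part _ ReB_le (@cfun_continuous _ _ f x)).
Qed.

Lemma cfun_Im_continuous f : continuous (fun x => complex.Im (f x)).
Proof.
by move=> x; exact: (cvg_complex_part _ ImB_le (@cfun_continuous _ _ f x)).
Qed.

Definition rcfun u (cu : continuous u) : cfun R K :=
  mkcfun (realC_continuous cu).

End RealParts.

Section FunctionalCalculus.
Variables (R : realType) (K : topologicalType).
Implicit Types f g : cfun R K.

Lemma cfunME f g x : cfun_fun (f ⋅ g) x = f x * g x. Proof. by []. Qed.
Lemma cfunDE f g x : cfun_fun (f + g) x = f x + g x. Proof. by []. Qed.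
Lemma cfunZE (k : R[i]) f x : cfun_fun (k *: f) x = k * f x. Proof. by []. Qed.
Lemma cfun_starE f x : cfun_fun (f^*') x = (f x)^*. Proof. by []. Qed.
Lemma cfunC f g : f ⋅ g = g ⋅ f.
Proof. by apply: cfunP => x; exact: mulrC. Qed.

Lemma rcfunE u (cu : continuous (u : K ->
  R)) x : cfun_fun (rcfun cu) x = (u x)%:C.
Proof. by []. Qed.

Lemma rcfun_star u (cu : continuous (u : K -> R)) : (rcfun cu)^*' = rcfun cu.
Proof. by apply: cfunP => x; exact: conjc_real. Qed.

Lemma cfun_sqr_continuous f : continuous (fun x => nrm (f x) ^+ 2).
Proof.
have E x : nrm (f x) ^+ 2 = complex.Re (f x) * complex.Re (f x) + complex.Im (f
  x) * complex.Im (f x).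
  by rewrite nrmcE sqr_sqrtr ?addr_ge0 ?sqr_ge0// !expr2.
have -> : (fun x => nrm (f x) ^+ 2) = (fun x =>
  complex.Re (f x) * complex.Re (f x) +
    complex.Im (f x) * complex.Im (f x)) by apply/funext.
move=> x; apply: cvgD; apply: cvgM;
  by [exact: cfun_Re_continuous | exact: cfun_Im_continuous].
Qed.

Lemma cfun_sqrE f : f^*' ⋅ f = rcfun (@cfun_sqr_continuous f).
Proof.
apply: cfunP => x; rewrite cfunME cfun_starE.
rewrite -[(f x)^*]/(conjc _) mulrC -sqr_normc nrmE -rmorphXn.
by [].
Qed.

End FunctionalCalculus.

Section Domination.
Variables (R : realType) (K : topologicalType) (A : cstarAlgType R).
Implicit Types f g : cfun R K.
Variable (phi : cfun R K -> A).
Hypothesis phiP : star_morphism phi.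

(** Contractivity for the uniform norm, with the square root now taken pointwise: [g = |f|^2] and
    [s = sqrt (1 - g^2)] satisfy the circle relation, which bounds [phi g], whose norm is the square
    of that of [phi f]. *)
Lemma cfun_nrm1 f : (forall x, nrm (f x) <= 1) -> nrm (phi f) <= 1.
Proof.
move=> f1; pose g x := nrm (f x) ^+ 2; pose s x := Num.sqrt (1 - g x * g x).
have cg : continuous g := @cfun_sqr_continuous _ _ f.
have cs : continuous s.
  move=> x; apply: (@continuous_comp _ _ _ (fun x => 1 - g x * g x)).
    by apply: cvgB; [exact: cvg_cst|apply: cvgM; exact: cg].
  exact: sqrt_continuous.
suff : nrm (phi (rcfun cg)) <= 1.
  have -> : rcfun cg = f^*' ⋅ f by rewrite cfun_sqrE; exact: cfunP.
  rewrite (star_morphismM phiP) (star_morphism_star phiP) nrm_cstar => ?.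
  by have := nrm_ge0 (phi f); nra.
apply: (nrm_circle (c := phi (rcfun cs))).
- by rewrite -(star_morphism_star phiP) rcfun_star.
- by rewrite -(star_morphism_star phiP) rcfun_star.
- by rewrite -!(star_morphismM phiP) cfunC.
rewrite -!(star_morphismM phiP) -(star_morphismD phiP) -(star_morphism1 phiP).
congr phi; apply: cfunP => x.
rewrite cfunDE !cfunME !rcfunE -!rmorphM -rmorphD; congr _%:C.
rewrite -[s x * s x]expr2 sqr_sqrtr ?subrKC// subr_ge0.
have gx0 : 0 <= g x by exact: sqr_ge0.
have gx1 : g x <= 1 by rewrite /g expr_le1// nrm_ge0.
nra.
Qed.

Lemma cfun_nrm_le f (c : R) : 0 <= c -> (forall x, nrm (f x) <= c) ->
  nrm (phi f) <= c.
Proof.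
move=> c0 fc; apply/ler_addgt0Pr => e e0.
have d0 : 0 < c + e by rewrite ltr_wpDl.
have := @cfun_nrm1 ((c + e)^-1%:C *: f).
rewrite (star_morphismZ phiP) nrmZr gtr0_norm ?invr_gt0// mulrC ler_pdivrMr//
  mul1r.
apply => x; rewrite cfunZE -[_ * _]/((c + e)^-1%:C *: (f x : R[i]^o)) nrmZr.
rewrite gtr0_norm ?invr_gt0// mulrC ler_pdivrMr// mul1r.
by apply: le_trans (fc x) _; rewrite lerDl ltW.
Qed.

Hypothesis phi_inj : injective phi.

(* With [g = |f|^2] and [phi g] of norm less than [c], the function
   [h = max (g - c, 0)] satisfies [h = h * g / max (g, c)], so that [phi h] is
   bounded by a proper fraction of its own norm. *)
Lemma nrm_cfun_le f x : nrm (f x) <= nrm (phi f).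
Proof.
rewrite leNgt; apply/negP => fx.
pose g x := nrm (f x) ^+ 2;
  have cg : continuous g := @cfun_sqr_continuous _ _ f.
pose b := nrm (phi f) ^+ 2.
have phig : nrm (phi (rcfun cg)) = b.
  have -> : rcfun cg = f^*' ⋅ f by rewrite cfun_sqrE; exact: cfunP.
  by rewrite (star_morphismM phiP) (star_morphism_star phiP) nrm_cstar.
have bg : b < g x by rewrite /b /g ltrXn2r// nrm_ge0.
have b0 : 0 <= b by exact: sqr_ge0.
(* Any [c] strictly between [b] and [g x] would do: [b / c < 1] forces [phi h = 0], whereas
   [h x = g x - c] is positive. *)
pose c := (b + g x) / 2; have bc : b < c by rewrite /c; lra.
have c0 : 0 < c by exact: le_lt_trans bc.
pose h y := Num.max (g y - c) 0; pose k y := (Num.max (g y) c)^-1.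
have ch : continuous h.
  move=> y; apply: (@continuous_max _ _ (fun y => g y - c) (fun=> 0)).
    by apply: cvgB; [exact: cg|exact: cvg_cst].
  exact: cvg_cst.
have m0 y : 0 < Num.max (g y) c by rewrite lt_max c0 orbT.
have ck : continuous k.
  move=> y; apply: cvgV; first by rewrite gt_eqF.
  by apply: (@continuous_max _ _ g (fun=> c)); [exact: cg|exact: cvg_cst].
have hE : rcfun ch = rcfun ck ⋅ rcfun cg ⋅ rcfun ch.
  apply: cfunP => y; rewrite !cfunME.
  rewrite !rcfunE -!rmorphM; congr _%:C.
  rewrite /h /k; case: (leP (g y) c) => gc.
    by rewrite max_r ?mulr0// subr_le0.
  by rewrite mulVf ?mul1r// gt_eqF// (lt_trans c0).
have phik : nrm (phi (rcfun ck)) <= c^-1.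
  apply: cfun_nrm_le => [|y]; first by rewrite invr_ge0 ltW.
  rewrite rcfunE nrmcE /= expr0n addr0 sqrtr_sqr.
  rewrite /k gtr0_norm ?invr_gt0// lef_pV2 ?posrE//.
  by rewrite le_max lexx orbT.
have phih : phi (rcfun ch) = 0.
  apply/eqP; rewrite -nrm_eq0; apply/negPn/negP => n0.
  have n1 : 0 < nrm (phi (rcfun ch)) by rewrite lt_neqAle nrm_ge0 eq_sym n0.
  have : nrm (phi (rcfun ch)) <= c^-1 * b * nrm (phi (rcfun ch)).
    rewrite {1}hE !(star_morphismM phiP); apply: (le_trans (nrmM _ _)).
    rewrite ler_pM2r//; apply: (le_trans (nrmM _ _)).
    by rewrite phig ler_wpM2r.
  by apply/negP; rewrite -ltNge gtr_pMl// mulrC ltr_pdivrMr// mul1r.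
have /phi_inj/(congr1 (fun f' : cfun R K => f' x)) : phi (rcfun ch) = phi 0.
  by rewrite phih (star_morphism0 phiP).
rewrite rcfunE => -[] /eqP; rewrite /h.
by rewrite max_l /c; [|lra]; apply/negP; rewrite gt_eqF//; lra.
Qed.

End Domination.

Lemma cfun_uniform_limit (R : realType) (K : topologicalType) (F : K -> R[i]) :
  (forall e, 0 < e -> exists f : cfun R K, forall x, nrm (F x - f x) <= e) ->
  continuous F.
Proof.
move=> FU x B /nrm_nbhs[e e0 sB].
have [|f fF] := FU (e / 3); first by rewrite divr_gt0.
have lN : nbhs (f x) [set w | nrm (f x - w) < e / 3].
  by apply/nrm_nbhs; exists (e / 3); rewrite ?divr_gt0.
have : nbhs x (f @^-1` [set w | nrm (f x - w) < e / 3]).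
  exact: (@cfun_continuous _ _ f x) lN.
apply: filterS => y /= xy; apply: sB.
have := nrmB (F x) (f x) (F y); have := nrmB (f x) (f y) (F y).
by have := fF x; have := fF y; rewrite (nrmC (F y)); lra.
Qed.

(** An injective [phi] is isometric for the uniform norm, so preimages of a convergent sequence are
    uniformly Cauchy; their pointwise limit is continuous and is sent to the limit of the
    sequence. *)
Lemma injective_range_closed (R : realType) (K : topologicalType) (A :
  cstarAlgType R)
    (phi : cfun R K -> A) :
  star_morphism phi -> injective phi -> closed (range phi).
Proof.
move=> phiP phi_inj; apply/nrm_closedP => a aP.
pose r n : R := 2^-1 ^+ n; have r0 n : 0 < r n by rewrite exprn_gt0// invr_gt0.
have [f fa] : {f : nat -> cfun R K & forall n, nrm (a - phi (f n)) < r n}.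
  apply: (@choice _ _ (fun n g => nrm (a - phi g) < r n)) => n.
  by have [_ [g _ <-]] := aP _ (r0 n); exists g.
have rS n : r n.+1 = r n / 2 by rewrite /r exprSr.
have ff n x : nrm (f n x - f n.+1 x) <= 2 * r n.
  apply: (le_trans (nrm_cfun_le phiP phi_inj (f n - f n.+1) x)).
  rewrite (star_morphismB phiP).
  have := nrmB (phi (f n)) a (phi (f n.+1)); have := fa n; have := fa n.+1.
  by rewrite rS (nrmC a (phi (f n))); have := r0 n; lra.
have q01 : 0 <= (2^-1 : R) < 1 by rewrite invr_ge0 ler0n invf_lt1// ltr1n.
have [F FP] : {F : K -> R[i] & forall x, forall e, 0 < e ->
    exists n, forall m, (n <= m)%N -> nrm (F x - f m x) < e}.
  apply: (@choice _ _ (fun x l => forall e, 0 < e ->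
    exists n, forall m, (n <= m)%N -> nrm (l - f m x) < e)) => x.
  by apply: (@nrm_geometric R R[i] (fun n => f n x) 2 _ q01) => n; exact: ff.
(* The bounds telescope since [2 r m = 4 (r m - r (m+1))]; hence the constant 4 below, and 5 once
   the error [r n] of [f n] is added. *)
have fnm n k x : nrm (f n x - f (n + k)%N x) <= 4 * (r n - r (n + k)%N).
  elim: k => [|k IH]; first by rewrite addn0 !subrr mulr0 nrm0.
  rewrite addnS; have := nrmB (f n x) (f (n + k)%N x) (f (n + k).+1 x).
  by have := ff (n + k)%N x; have := rS (n + k)%N; lra.
have Fn n x : nrm (F x - f n x) <= 4 * r n.
  apply/ler_addgt0Pr => e /(FP x)[m Fm].
  have := nrmB (F x) (f (n + m)%N x) (f n x).
  have := Fm (n + m)%N (leq_addl _ _); have := fnm n m x.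
  by rewrite (nrmC (f n x)); have := r0 (n + m)%N; lra.
have rsmall (e : R) : 0 < e -> exists n, r n < e.
  by move=> /(geometric_small ler01 q01)[n]; rewrite mul1r; exists n.
have cF : continuous F.
  apply: cfun_uniform_limit => e e0; have [|n rn] := rsmall (e / 4).
    by rewrite divr_gt0.
  by exists (f n) => x; have := Fn n x; lra.
exists (mkcfun cF) => //; apply/eqP; rewrite -subr_eq0;
  apply/eqP/nrm_eq0P => e e0.
have [|n rn] := rsmall (e / 5); first by rewrite divr_gt0.
have := nrmB (phi (mkcfun cF)) (phi (f n)) a; rewrite -(star_morphismB phiP).
have : nrm (phi (mkcfun cF - f n)) <= 4 * r n.
  by apply: (cfun_nrm_le phiP) => [|x]; [rewrite mulr_ge0// ltW|exact: Fn].
by have := fa n; rewrite (nrmC a); lra.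
Qed.

(** * Tietze extension for complex functions *)

(* The same uniform space, with balls of real radius: the normality of
   pseudometric spaces is only available over a [realType]. *)
Definition realified (T : Type) : Type := T.

Section Realified.
Variables (R : realType) (V : pseudoMetricType R[i]).
Local Notation VR := (realified V).

HB.instance Definition _ := Uniform.copy VR V.

Definition realified_ball (x : VR) (e : R) : set VR := ball (x : V) e%:C.

Fact realified_center x (e : R) : 0 < e -> realified_ball x e x.
Proof. by move=> e0; apply: ballxx; rewrite ltcR. Qed.
Fact realified_sym x y (e : R) : realified_ball x e y -> realified_ball y e x.
Proof. exact: ball_sym. Qed.
Fact realified_triangle x y z (e1 e2 : R) :
  realified_ball x e1 y -> realified_ball y e2 z ->
    realified_ball x (e1 + e2) z.
Proof. by rewrite /realified_ball rmorphD; exact: ball_triangle. Qed.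
Fact realified_entourage : @entourage VR = entourage_ realified_ball.
Proof.
rewrite -[LHS]/(@entourage V) -entourage_ballE; apply/seteqP;
  split=> B [e e0 sB].
  by have [r r0 er] := posC e0; exists r => //; rewrite /realified_ball -er.
by exists e%:C; rewrite //= ltcR.
Qed.

HB.instance Definition _ := Uniform_isPseudoMetric.Build R VR
  realified_center realified_sym realified_triangle realified_entourage.

Lemma complex_pseudometric_normal : normal_space V.
Proof. exact: (@pseudometric_normal R VR). Qed.

End Realified.

Lemma squash_continuous (R : realType) (K : topologicalType) (f : K -> R) :
  continuous f -> continuous (fun x => f x / (1 + `|f x|)).
Proof.
move=> cf x; apply: cvgM; first exact: cf.
apply: cvgV; first by rewrite gt_eqF// ltr_pwDl.
by apply: cvgD; [exact: cvg_cst|apply: cvg_norm; exact: cf].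
Qed.

Section Extension.
Variables (R : realType) (X : topologicalType) (A : set X).
Hypotheses (normalX : normal_space X) (cA : closed A).

(* [f] may be unbounded: extend [h = f / (1 + |f|)] to [H] and divide by
   [1 - |H| + d], where [d] vanishes on [A] and is 1 where [|H|] is. *)
Lemma tietze_real (f : A -> R) : continuous f ->
  exists2 g : X -> R, continuous g & forall x : A, g (set_val x) = f x.
Proof.
move=> cf; pose h (x : A) : R := f x / (1 + `|f x|).
have f1 x : 0 < 1 + `|f x| by rewrite ltr_pwDl.
have ch : continuous h by exact: squash_continuous.
have hE x : `|h x| = `|f x| / (1 + `|f x|).
  by rewrite normrM normfV [`|1 + _|]ger0_norm// ltW.
have h1 x : `|h x| < 1 by rewrite hE ltr_pdivrMr// mul1r ltrDr.
(* [valL_ 0 h] is [h] made total with the value 0 off [A]; the extension theorem looks only at its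
   values and continuity within [A]. *)
have valE (x : A) : valL_ (0 : R) h (set_val x) = h x.
  by rewrite -[in RHS](@valLK _ _ (0 : R) A h).
have valA x : A x -> exists y : A, set_val y = x.
  by move=> Ax; exists (exist _ x (mem_set Ax)).
have [||H [HE cH H1]] := continuous_bounded_extension normalX cA (M :=
  1) (f := valL_ (0 : R) h) ltr01.
- exact/subspace_valL_continuousP'.
- by move=> x /valA[y <-]; rewrite valE ltW.
have HE' (x : A) : H (set_val x) = h x.
  by rewrite -HE ?valE//; case: x.
pose B := [set x | 1 <= `|H x|].
have cnH : continuous (fun x => `|H x|).
  move=> x; apply: (@continuous_comp _ _ _ H (fun r : R => `|r|));
    first exact: cH.
  exact: (@norm_continuous R R).
have cB : closed B.
  have -> : B = (fun x => `|H x|) @^-1` [set r | 1 <= r] by [].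
  by apply: preimage_closed => [x _|]; [exact: cnH|exact: closed_ge].
have AB : A `&` B = set0.
  apply/seteqP; split=> x // [/valA[y <-]]; rewrite /B /= HE' leNgt.
  by rewrite h1.
have [d [cd dA dB d01]] := @urysohn_ext_itv X R normalX A B 0 1 cA cB AB ltr01.
have d0 x : 0 <= d x by have /d01 : range d (d x) by [];
  rewrite /= in_itv /= => /andP[].
have D0 x : 0 < 1 - `|H x| + d x.
  have [Hx|Hx] := ltP `|H x| 1; first by have := d0 x; lra.
  have /dB/= -> : (d @` B) (d x) by exists x.
  by have := H1 x; lra.
exists (fun x => H x / (1 - `|H x| + d x)) => [x|x].
  apply: cvgM; first exact: cH.
  apply: cvgV; first by rewrite gt_eqF.
  apply: cvgD; last exact: cd.
  by apply: cvgB; [exact: cvg_cst|exact: cnH].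
have /dA/= -> : (d @` A) (d (set_val x)).
  by exists (set_val x) => //; exact: set_valP.
rewrite addr0 HE' hE /h.
have -> : 1 - `|f x| / (1 + `|f x|) = (1 + `|f x|)^-1.
  by apply: (mulIf (lt0r_neq0 (f1 x))); rewrite mulrBl divfK ?mulVf ?gt_eqF//;
    lra.
by rewrite invrK divfK// gt_eqF.
Qed.

Lemma tietze_complex (f : cfun R A) :
  exists2 g : X -> R[i], continuous g & forall x : A, g (set_val x) = f x.
Proof.
have [u cu uE] := tietze_real (@cfun_Re_continuous _ _ f).
have [v cv vE] := tietze_real (@cfun_Im_continuous _ _ f).
exists (fun x => (u x)%:C + 'i%C * (v x)%:C) => [x|x].
  apply: cvgD; first exact: realC_continuous.
  by apply: cvgM; [exact: cvg_cst|exact: realC_continuous].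
by rewrite uE vE -complexE.
Qed.

End Extension.

(** * Rank one projections *)

Section RankOne.
Variables (R : realType) (N : nat).
Implicit Types (z w : 'cV[R[i]]_N) (p q : 'M[R[i]]_N) (X : set 'cV[R[i]]_N).

Lemma conj_realC (r : R) : (r%:C)^* = r%:C :> R[i].
Proof. exact: conjc_real. Qed.

Definition rankone z : 'M[R[i]]_N := \matrix_(i, j) (z i 0 * (z j 0)^*).

Lemma rankoneZ (u : R[i]) z : `|u| = 1 -> rankone (u *: z) = rankone z.
Proof.
move=> u1; apply/matrixP => i j; rewrite !mxE rmorphM mulrACA.
by rewrite -normCK u1 expr1n mul1r.
Qed.

Lemma rankone_tr z : (rankone z)^T = rankone (map_mx Num.conj z).
Proof. by apply/matrixP => i j; rewrite !mxE conjCK mulrC. Qed.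

Lemma rankone_mx z : rankone z = z *m (map_mx Num.conj z)^T.
Proof. by apply/matrixP => i j; rewrite !mxE big_ord1 !mxE. Qed.

Lemma csphere_neq0 z : csphere R N z -> exists k, z k 0 != 0.
Proof.
move=> z1; apply: contrapT => z0; move: z1; rewrite /csphere /= big1.
  by move/eqP; rewrite eq_sym oner_eq0.
move=> k _; have [->|zk] := eqVneq (z k 0) 0; first by rewrite normr0 expr0n.
by case: z0; exists k.
Qed.

Lemma rankone_cproj z : csphere R N z -> cproj_space R N (rankone z).
Proof.
move=> z1; have dot : (map_mx Num.conj z)^T *m z = 1%:M.
  apply/matrixP => i j; rewrite !ord1 !mxE -[RHS]z1.
  by apply: eq_bigr => k _; rewrite !mxE normCKC.
split.
- by apply/matrixP => i j; rewrite !mxE rmorphM /= conjCK mulrC.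
- by rewrite rankone_mx mulmxA -(mulmxA z) dot mulmx1.
- have [k zk] := csphere_neq0 z1; apply/eqP; rewrite eqn_leq; apply/andP; split.
    by rewrite rankone_mx (leq_trans (mulmx_max_rank _ _)).
  rewrite lt0n mxrank_eq0; apply/eqP => /matrixP /(_ k k) /eqP.
  by rewrite !mxE mulf_eq0 conjC_eq0 orbb (negPf zk).
Qed.

Lemma torus_rankone_real z :
  torus_rsphere R N z -> forall i j, z i 0 * (z j 0)^* = z j 0 * (z i 0)^*.
Proof.
move=> [u [y [u1 _ ->]]] i j; rewrite !mxE !rmorphM /= !conj_realC.
by rewrite mulrACA [in RHS]mulrACA [(y i 0)%:C * _]mulrC.
Qed.

Lemma rankone_rproj z : torus_rsphere R N z -> rproj_space R N (rankone z).
Proof.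
move=> [u [y [u1 y1 ->]]]; rewrite rankoneZ//.
have yE : map_mx Num.conj (map_mx (real_complex R) y) = map_mx (real_complex R)
  y.
  by apply/matrixP => i j; rewrite !mxE conj_realC.
exists (y *m y^T); last by rewrite rankone_mx yE map_mxM map_trmx.
have dot : y^T *m y = 1%:M.
  apply/matrixP => i j; rewrite !ord1 !mxE -[RHS]y1.
  by apply: eq_bigr => k _; rewrite !mxE expr2.
split.
- by rewrite trmx_mul trmxK.
- by rewrite mulmxA -(mulmxA y) dot mulmx1.
- apply/eqP; rewrite eqn_leq (leq_trans (mulmx_max_rank _ _))// lt0n mxrank_eq0.
  apply/eqP => y0; have := congr1 (mulmx y^T) y0.
  rewrite mulmxA dot mul1mx mulmx0 => /(congr1 (mulmx^~ y)).
  rewrite dot mul0mx => /matrixP /(_ 0 0) /eqP.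
  by rewrite !mxE eqxx oner_eq0.
Qed.

Lemma cproj_tr p : cproj_space R N p -> cproj_space R N p^T.
Proof.
move=> [ph pp pr]; split.
- by rewrite trmxK -[in RHS]ph; apply/matrixP => i j; rewrite !mxE.
- by rewrite -trmx_mul pp.
- by rewrite mxrank_tr.
Qed.

Lemma rproj_tr p : rproj_space R N p -> rproj_space R N p^T.
Proof. by move=> [q [qt qq qr] <-]; exists q => //; rewrite map_trmx qt. Qed.

Lemma mx_nbhs m n (p : 'M[R[i]]_(m, n)) (B : set 'M[R[i]]_(m, n)) :
  nbhs p B <-> exists2 e : R, 0 < e &
    forall q : 'M[R[i]]_(m, n), (forall i j, nrm (p i j - q i j) < e) -> B q.
Proof.
rewrite -nbhs_ballE; split => [[e /posC[r r0 ->] sB]|[e e0 sB]].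
  exists r => // q pq; apply: sB; split => [|i j]; first by rewrite ltcR.
  exact/nrm_ball/pq.
exists e%:C; first by rewrite /= ltcR.
by move=> q [_ pq]; apply: sB => i j; exact/nrm_ball/pq.
Qed.

Lemma cvg_coord m n (p : 'M[R[i]]_(m, n)) i j :
  (fun q : 'M[R[i]]_(m, n) => q i j) @ p --> p i j.
Proof. exact: coord_continuous. Qed.

Lemma cvg_mx (T : Type) (F : set_system T) m n (g : T -> 'M[R[i]]_(m, n))
    (p : 'M[R[i]]_(m, n)) :
  Filter F -> (forall i j, (fun t => g t i j) @ F --> p i j) -> g @ F --> p.
Proof.
move=> FF gp B /mx_nbhs[e e0 sB].
have : F [set t | forall i j, nrm (p i j - g t i j) < e].
  apply: filter_forall => i; apply: filter_forall => j.
  have lN : nbhs (p i j) [set w | nrm (p i j - w) < e] by apply/nrm_nbhs;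
    exists e.
  exact: (gp i j) lN.
move=> gB; suff : F (g @^-1` B) by [].
by apply: filterS gB => t /= tp; exact: sB.
Qed.

Lemma cvg_realC (T : Type) (F : set_system T) (u : T -> R) (l : R) : Filter F ->
  u @ F --> l -> (fun t => (u t)%:C : R[i]) @ F --> (l%:C : R[i]).
Proof.
move=> FF ul; apply: (cvg_comp _ _ ul).
by apply: (@realC_continuous R R id) => x; exact: cvg_id.
Qed.

Lemma cvg_conj (T : Type) (F : set_system T) (g : T ->
  R[i]) (l : R[i]) : Filter F ->
  g @ F --> l -> (fun t => (g t)^*) @ F --> l^*.
Proof.
move=> FF gl; apply/cvgrPdist_lt => e e0; move/cvgrPdist_lt : gl => /(_ e e0).
by apply: filterS => t; rewrite -rmorphB norm_conjC.
Qed.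

Lemma cvg_csum (T I : Type) (F : set_system T) (s : seq I) (g : I -> T -> R[i])
    (l : I -> R[i]) : Filter F -> (forall i, g i @ F --> l i) ->
  (fun t => \sum_(i <- s) g i t) @ F --> \sum_(i <- s) l i.
Proof. by move=> FF gl; apply: cvg_big => // ; exact: add_continuous. Qed.

(** Continuity is asked at [t] and agreement near [t] only, because it is applied to
    [line_section k], which behaves well only where the diagonal entry [k] is positive. *)
Lemma closure_eq (T : topologicalType) (S : set T) (t : T) (f g : T -> R[i]) :
  closure S t -> f @ t --> f t -> g @ t --> g t ->
  (exists2 B, nbhs t B & forall s, B s -> S s -> f s = g s) -> f t = g t.
Proof.
move=> St ft gt [B tB fg]; apply/eqP; rewrite -subr_eq0; apply/eqP.
apply: (@nrm_eq0P R R[i]) => e e0.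
have e20 : 0 < e / 2 by rewrite divr_gt0.
have fN : nbhs t (f @^-1` [set w | nrm (f t - w) < e / 2]).
  by apply: ft; apply/nrm_nbhs; exists (e / 2).
have gN : nbhs t (g @^-1` [set w | nrm (g t - w) < e / 2]).
  by apply: gt; apply/nrm_nbhs; exists (e / 2).
have [s [Ss [[/= fs gs] Bs]]] := St _ (filterI (filterI fN gN) tB).
have := nrmB (f t) (f s) (g t); rewrite {2}(fg _ Bs Ss) (nrmC (g s)).
by move: fs gs; lra.
Qed.

(* A unit vector spanning the line of the rank one projection [q], defined where
   [q k k] is nonzero. *)
Definition line_section k q : 'cV[R[i]]_N :=
  \col_i (q i k * (Num.sqrt (complex.Re (q k k)))^-1%:C).

Lemma cvg_line_section (T : Type) (F : set_system T) (g : T -> 'M[R[i]]_N) p k :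
  Filter F -> (forall i j, (fun t => g t i j) @ F --> p i j) ->
  0 < complex.Re (p k k) ->
  (fun t => line_section k (g t)) @ F --> line_section k p.
Proof.
move=> FF gp pk.
have gRe : (fun t => complex.Re (g t k k)) @ F --> complex.Re (p k k).
  by apply: (cvg_complex_part _ (@ReB_le R)); exact: gp.
apply: cvg_mx => i j; rewrite !mxE.
under eq_fun do rewrite mxE.
apply: cvgM; first exact: gp.
apply: cvg_realC; apply: cvgV; first by rewrite gt_eqF// sqrtr_gt0.
exact: (cvg_comp _ _ gRe (@sqrt_continuous R _)).
Qed.

Lemma cvg_rankone (T : Type) (F : set_system T) (g : T -> 'cV[R[i]]_N) z i j :
  Filter F -> g @ F --> z ->
  (fun t => rankone (g t) i j) @ F --> rankone z i j.
Proof.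
move=> FF gz.
have gc a : (fun t => g t a 0) @ F --> z a 0.
  exact: (cvg_comp _ _ gz (@cvg_coord _ _ z a 0)).
rewrite mxE; under eq_fun do rewrite mxE.
by apply: cvgM; [exact: gc|apply: cvg_conj; exact: gc].
Qed.

(** A limit [p] has trace 1, hence a diagonal entry with positive real part, and [line_section k] is
    continuous there. On nearby points [rankone z] the section is a unimodular multiple of [z], so
    lies in [X] by invariance; so does its value at [p], which spans the line of [p]. *)
Lemma classical_projective_closed X : X `<=` csphere R N -> closed X ->
  (forall (u : R[i]) z, `|u| = 1 -> X z -> X (u *: z)) ->
  closed (classical_projective X).
Proof.
move=> Xs cX XT p pX.
have ctr : (fun q => \sum_k q k k) @ p --> \sum_k p k k.
  have := @cvg_csum _ _ _ (index_enum 'I_N) (fun k q => q k k) (fun k =>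
    p k k) (nbhs_filter p).
  by apply => k; exact: cvg_coord.
have trp : \sum_k p k k = 1.
  apply: (closure_eq (f := fun q => \sum_k q k k) (g := fun=> 1) pX).
  - exact: ctr.
  - exact: cst_continuous.
  - exists setT => [|_ _ [z /Xs z1 <-]];
      first exact: (@filterT _ _ (nbhs_filter p)).
    rewrite -[RHS]z1.
    by apply: eq_bigr => k _; rewrite !mxE normCK.
have [k pk] : exists k, 0 < complex.Re (p k k).
  apply: contrapT => pk.
  have : complex.Re (\sum_k p k k) <= 0.
    rewrite raddf_sum sumr_le0// => k _; rewrite leNgt.
    by apply/negP => pk0; apply: pk; exists k.
  by rewrite trp /= ler10.
have cs : line_section k @ p --> line_section k p.
  exact: (@cvg_line_section _ _ id p k (nbhs_filter p) (@cvg_coord _ _ p) pk).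
have cRe : (fun q => complex.Re (q k k)) @ p --> complex.Re (p k k).
  exact: (cvg_complex_part (nbhs_filter p) (@ReB_le R) (@cvg_coord _ _ p k k)).
have near_pos : nbhs p [set q : 'M[R[i]]_N | 0 < complex.Re (q k k)].
  exact: (@cvgr_gt _ _ _ (nbhs_filter p) _ _ cRe _ pk).
have sX q : classical_projective X q -> 0 < complex.Re (q k k) ->
    X (line_section k q) /\ rankone (line_section k q) = q.
  move=> [z Xz <-]; rewrite !mxE => zk.
  have E : z k 0 * (z k 0)^* = (nrm (z k 0) ^+ 2)%:C.
    by rewrite -normCK nrmE -rmorphXn.
  have zk0 : nrm (z k 0) != 0.
    by apply: contraTneq zk => zk0; rewrite E zk0 expr0n /= ltxx.
  rewrite -[\matrix_(i, j) _]/(rankone z).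
  have sE : line_section k (rankone z) = ((z k 0)^* * (nrm (z k 0))^-1%:C) *: z.
    apply/matrixP => i j; rewrite !mxE ord1 E /= sqrtr_sqr ger0_norm ?nrm_ge0//.
    by rewrite [RHS]mulrC mulrA.
  have u1 : `|(z k 0)^* * (nrm (z k 0))^-1%:C| = 1.
    rewrite normrM norm_conjC nrmE ger0_norm ?ler0c ?invr_ge0 ?nrm_ge0//.
    by rewrite -rmorphM divff.
  by rewrite sE rankoneZ//; split => //; exact: XT.
have Xsp : X (line_section k p).
  apply: cX => B /cs Bs.
  have Bp : nbhs p (line_section k @^-1` B) by exact: Bs.
  have [q [qX [Bq q0]]] := pX _ (@filterI _ _ (nbhs_filter p) _ _ Bp near_pos).
  by exists (line_section k q); split => //; have [] := sX q.
exists (line_section k p) => //; apply/matrixP => i j.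
apply: (closure_eq (f := fun q =>
  rankone (line_section k q) i j) (g := fun q => q i j) pX).
- exact: (@cvg_rankone _ _ (line_section k) (line_section k p) i j (nbhs_filter
    p) cs).
- exact: cvg_coord.
- exists [set q : 'M[R[i]]_N | 0 < complex.Re (q k k)]; first exact: near_pos.
  by move=> q q0 qX; have [_ ->] := sX q qX q0.
Qed.

(** If all [z_i conj(z_k)] are real, dividing [z] by the phase of a nonzero coordinate [z_k] makes
    it real. *)
Lemma torus_rsphereP z : csphere R N z ->
  torus_rsphere R N z <-> forall i j, complex.Im (rankone z i j) = 0.
Proof.
move=> z1; split=> [[u [y [u1 _ ->]]] i j|zr].
  rewrite rankoneZ// !mxE conj_realC -rmorphM.
  by [].
have [k zk] := csphere_neq0 z1.
pose c := nrm (z k 0); have c0 : c%:C != 0 :> R[i] by rewrite -nrmE normr_eq0.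
have uu : `|z k 0 / c%:C| = 1.
  by rewrite normrM normfV nrmE -/c ger0_norm ?ler0c ?nrm_ge0// divff.
pose y : 'cV[R]_N := \col_i complex.Re (z i 0 * (z k 0 / c%:C)^*).
have yE i : (y i 0)%:C = z i 0 * (z k 0 / c%:C)^*.
  rewrite mxE [RHS]complexE; set w := _ * _.
  have -> : complex.Im w = 0.
    rewrite /w rmorphM fmorphV /= conj_realC mulrA -fmorphV.
    rewrite mulrC; have := zr i k; rewrite mxE.
    by case: (_ * _) => a b /= ->; rewrite mul0r mulr0 addr0.
  by rewrite mulr0 addr0.
have zE : z = (z k 0 / c%:C) *: map_mx (real_complex R) y.
  apply/matrixP => i j; rewrite ord1 !mxE.
  by have := yE i; rewrite mxE => ->; rewrite mulrCA -normCK uu expr1n mulr1.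
exists (z k 0 / c%:C), y; split => //.
apply: (@complexI R); rewrite rmorph_sum /= -[RHS]z1.
apply: eq_bigr => i _; rewrite rmorphXn /=.
have -> : (y i 0)%:C ^+ 2 = `|(y i 0)%:C| ^+ 2 :> R[i] by rewrite normCK
  conj_realC expr2.
by rewrite yE normrM norm_conjC uu mulr1.
Qed.

End RankOne.

Section Kinds.
Variables (R : realType) (N : nat) (x : sphere_kind) (X : set 'cV[R[i]]_N).
Hypotheses (Xs : X `<=` csphere R N) (cX : closed X) (XO2 : O2_invariant X).
Local Notation P := (kind_proj_space R N x).
Local Notation PX := (kind_projective x X).

Lemma map_conj_torus (z : 'cV[R[i]]_N) :
  torus_rsphere R N z -> torus_rsphere R N (map_mx Num.conj z).
Proof.
move=> [u [y [u1 y1 ->]]]; exists u^*, y; split => //.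
  by rewrite norm_conjC.
by apply/matrixP => i j; rewrite !mxE rmorphM /= conj_realC.
Qed.

Lemma kind_projectiveP (p : 'M[R[i]]_N) : PX p ->
  exists z, [/\ X z, p = rankone z &
  match x with DoubleStar | Star => True | _ => torus_rsphere R N z end].
Proof. by case: x => [] [z Xz <-]; exists z; split => //; case: Xz. Qed.

Lemma kind_projective_closed : closed PX.
Proof.
have cPX := classical_projective_closed Xs cX XO2.1.
(* [PX^-] is the set of points of [PX] with real entries, a closed condition on matrices. *)
have E : classical_projective (X `&` torus_rsphere R N) = classical_projective X
    `&` \bigcap_(ij in [set: 'I_N * 'I_N]) [set p | complex.Im (p ij.1 ij.2) =
      0].
  apply/seteqP; split=> [_ [z [Xz zt] <-]|p [[z Xz <-] pr]].
    split; first by exists z.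
    by move=> ij _; exact: ((torus_rsphereP (Xs Xz)).1 zt).
  exists z => //; split => //; apply/(torus_rsphereP (Xs Xz)) => i j.
  exact: (pr (i, j) I).
have cr : closed (\bigcap_(ij in [set: 'I_N * 'I_N])
    [set p : 'M[R[i]]_N | complex.Im (p ij.1 ij.2) = 0]).
  apply: closed_bigI => -[i j] _ p pC.
  apply/eqP/negPn/negP => /= p0.
  have pp : 0 < `|complex.Im (p i j)| by rewrite normr_gt0.
  have [q [/= q0 pq]] : [set q : 'M[R[i]]_N | complex.Im (q i j) = 0] `&`
      [set q | forall a b, nrm (p a b - q a b) < `|complex.Im (p i j)|] !=set0.
    by apply: pC; apply/mx_nbhs; exists `|complex.Im (p i j)|.
  have := le_lt_trans (ImB_le (p i j) (q i j)) (pq i j).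
  by rewrite q0 subr0 ltxx.
by case: x; rewrite /kind_projective ?E//; exact: closedI.
Qed.

Lemma kind_projective_sub : PX `<=` P.
Proof.
case: x => _ [z Xz <-] /=;
  first [exact: (rankone_cproj (Xs Xz)) | exact: (rankone_rproj Xz.2)].
Qed.

Lemma kind_proj_tr (p : 'M[R[i]]_N) : P p -> P p^T.
Proof. by case: x;
  [exact: cproj_tr|exact: cproj_tr|exact: rproj_tr|exact: rproj_tr]. Qed.

(** Transposing [rankone z] amounts to conjugating [z]: here invariance of [X] under conjugation
    enters. *)
Lemma kind_projective_tr (p : 'M[R[i]]_N) : PX p -> PX p^T.
Proof.
have [_ XC] := XO2.
case: x => [] [z Xz <-]; rewrite -[\matrix_(i, j) _]/(rankone z) rankone_tr.
- by exists (map_mx Num.conj z) => //; exact: XC.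
- by exists (map_mx Num.conj z) => //; exact: XC.
- by exists (map_mx Num.conj z) => //; case: Xz => Xz zt; split;
    [exact: XC|exact: map_conj_torus].
- by exists (map_mx Num.conj z) => //; case: Xz => Xz zt; split;
    [exact: XC|exact: map_conj_torus].
Qed.

End Kinds.

(** * Generated subalgebras and ideals *)

Section Generated.
Variables (R : realType) (A : cstarAlgType R).
Implicit Types G B K : set A.

Lemma cstar_generated_subalgebra G : cstar_subalgebra (cstar_generated G).
Proof.
split.
- by move=> B [BP _]; exact: subalg1.
- by move=> k a b Ga Gb B BG; apply: subalgP; [case: BG|exact: Ga|exact: Gb].
- by move=> a b Ga Gb B BG; apply: subalgM; [case: BG|exact: Ga|exact: Gb].
- by move=> a Ga B BG; apply: subalg_star; [case: BG|exact: Ga].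
- by apply: closed_bigI => B [BP _]; exact: (Defs.subalg_closed BP).
Qed.

Lemma ideal_generated_closed_ideal G : closed_ideal (ideal_generated G).
Proof.
split.
- by move=> K [KP _]; exact: ideal0.
- by move=> a b Ga Gb K KG; apply: idealD; [case: KG|exact: Ga|exact: Gb].
- by move=> a b Gb K KG; apply: idealMl; [case: KG|exact: Gb].
- by move=> a b Ga K KG; apply: Defs.idealMr; [case: KG|exact: Ga].
- by apply: closed_bigI => K [KP _]; exact: ideal_closed.
Qed.

Lemma closed_preimage_nrm (B : cstarAlgType R) (f : A -> B) (C : set B) :
  (forall a b, nrm (f a - f b) <= nrm (a - b)) -> closed C ->
    closed (f @^-1` C).
Proof.
move=> fl /nrm_closedP cC; apply/nrm_closedP => a aP;
  apply: cC => e /aP[b Cb ab].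
by exists (f b) => //; exact: le_lt_trans (fl _ _) ab.
Qed.

Lemma ideal_generated_star G : (forall a, G a -> G a^*') ->
  forall a, ideal_generated G a -> ideal_generated G a^*'.
Proof.
move=> Gs a; have GP := ideal_generated_closed_ideal G.
suff : closed_ideal [set b | ideal_generated G b^*'].
  move=> KP Ga; apply: (Ga [set b | ideal_generated G b^*']); split => // b Gb.
  exact: sub_smallest (Gs _ Gb).
split.
- by rewrite /= star0; exact: (ideal0 GP).
- by move=> b c /= Gb Gc; rewrite starD; exact: (idealD GP).
- by move=> b c /= Gc; rewrite starM; exact: (Defs.idealMr GP).
- by move=> b c /= Gb; rewrite starM; exact: (idealMl GP).
- apply: (@closed_preimage_nrm A star); last exact: (ideal_closed GP).
  by move=> b c; rewrite -starB nrm_star.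
Qed.

End Generated.

Lemma star_morphism_kernel (R : realType) (A B : cstarAlgType R) (f : A -> B) :
  star_morphism f -> closed_ideal [set a | f a = 0].
Proof.
move=> fP; split.
- exact: star_morphism0.
- by move=> a b /= a0 b0; rewrite (star_morphismD fP) a0 b0 addr0.
- by move=> a b /= b0; rewrite (star_morphismM fP) b0 smul0r.
- by move=> a b /= a0; rewrite (star_morphismM fP) a0 smul0l.
- apply: (@closed_preimage_nrm R A B f [set 0]); last first.
    apply/nrm_closedP => v ve; apply: nrm_eq0P => e /ve[_ ->].
    by rewrite subr0 => /ltW.
  by move=> a b; rewrite -(star_morphismB fP) star_morphism_nrm.
Qed.

(** Settles the limit case of inductions on functions. Both sides are Lipschitz for the uniform
    distance, so equality passes from approximants to [f], with two errors of at most [C d] each. *)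
Lemma uniform_lipschitz_eq (R : realType) (K : topologicalType) (B :
  cstarAlgType R)
    (alpha beta : cfun R K -> B) (C : R) (f : cfun R K) :
  let lip (a : cfun R K -> B) := forall (g h : cfun R _) (e : R), 0 <= e ->
    (forall x, nrm (g x - h x) <= e) -> nrm (a g - a h) <= C * e in
  lip alpha -> lip beta ->
  (forall e : R, 0 < e ->
     exists2 g, alpha g = beta g & forall x, nrm (f x - g x) <= e) ->
  alpha f = beta f.
Proof.
move=> lip la lb fg; apply/eqP; rewrite -subr_eq0; apply/eqP/nrm_eq0P => e e0.
have C1 : 0 < 2 * `|C| + 1 by rewrite ltr_wpDl// mulr_ge0.
pose d := e / (2 * `|C| + 1); have d0 : 0 < d by rewrite divr_gt0.
have [g gE gd] := fg d d0.
have := nrmB (alpha f) (alpha g) (beta f); rewrite {2}gE (nrmC (beta g)).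
have := la f g d (ltW d0) gd; have := lb f g d (ltW d0) gd.
have dE : d * (2 * `|C| + 1) = e by rewrite divfK// gt_eqF.
have := ler_norm C; nra.
Qed.

(** * Density of the polynomials in the coordinates *)

Section Identification.
Variables (R : realType) (N : nat) (Z : nc_space R N) (P : set 'M[R[i]]_N).
Variable ip : cfun R P -> Z.
Hypothesis hip : projective_identification ip.

Lemma identification_star : star_morphism ip.
Proof. exact: coordinate_embedding_star hip.1. Qed.

Lemma identification_inj : injective ip.
Proof. exact: coordinate_embedding_inj hip.1. Qed.

Lemma identification_coord i j : ip (coordinate P i j) = pcoord Z i j.
Proof. exact: coordinate_embedding_coord hip.1 i j. Qed.

(* Since [ip] is isometric onto the closed algebra generated by the [p_ij], the
   hypothesis on its range plays the role of the Stone-Weierstrass theorem. *)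
Lemma identification_ind (Q : cfun R P -> Prop) :
  Q sone -> (forall k f g, Q f -> Q g -> Q (k *: f + g)) ->
  (forall f g, Q f -> Q g -> Q (f ⋅ g)) -> (forall f, Q f -> Q f^*') ->
  (forall i j, Q (coordinate P i j)) ->
  (forall f : cfun R P, (forall e : R, 0 < e ->
     exists2 g, Q g & forall x, nrm (f x - g x) <= e) -> Q f) ->
  forall f, Q f.
Proof.
move=> Q1 QL QM QS Qc Qlim f.
have ipP := identification_star; have ip_inj := identification_inj.
have rE : range ip = cstar_generated [set pcoord Z i j | i in setT & j in setT].
  exact: hip.2.
suff sub : range ip `<=` ip @` Q.
  have [|g Qg /ip_inj <-//] := sub (ip f); by exists f.
rewrite rE; apply: smallest_sub; last first.
  by move=> _ [i _ [j _ <-]]; exists (coordinate P i j) => //;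
    rewrite identification_coord.
split.
- by exists sone => //; exact: (star_morphism1 ipP).
- move=> k _ _ [g Qg <-] [h Qh <-]; exists (k *: g + h); first exact: QL.
  by rewrite (star_morphismD ipP) (star_morphismZ ipP).
- move=> _ _ [g Qg <-] [h Qh <-]; exists (g ⋅ h); first exact: QM.
  by rewrite (star_morphismM ipP).
- move=> _ [g Qg <-]; exists g^*'; first exact: QS.
  by rewrite (star_morphism_star ipP).
(* A limit of elements [ip g] with [Q g] stays in the closed range of [ip], say as [ip h]; isometry
   makes these [g] approximate [h] uniformly. *)
apply/nrm_closedP => a aQ.
have [h _ ha] : range ip a.
  have := Defs.subalg_closed (cstar_generated_subalgebra [set pcoord Z i j | i
    in setT & j in setT]).
  rewrite -rE => /nrm_closedP; apply => e /aQ[_ [g _ <-] ag].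
  by exists (ip g) => //; exists g.
exists h => //; apply: Qlim => e /aQ[_ [g Qg <-] ag]; exists g => // y.
apply: le_trans (nrm_cfun_le ipP ip_inj (h - g) y) _.
by rewrite (star_morphismB ipP) ha ltW.
Qed.

Lemma lipschitz_star_morphism (B : cstarAlgType R) (psi : cfun R P -> B) :
  star_morphism psi -> forall (g h : cfun R _) (e : R), 0 <= e ->
    (forall x, nrm (g x - h x) <= e) -> nrm (psi g - psi h) <= e.
Proof.
by move=> psiP g h e e0 gh; rewrite -(star_morphismB psiP) cfun_nrm_le.
Qed.

Lemma identification_eq (B : cstarAlgType R) (psi psi' : cfun R P -> B) :
  star_morphism psi -> star_morphism psi' ->
  (forall i j, psi (coordinate P i j) = psi' (coordinate P i j)) -> psi =1 psi'.
Proof.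
move=> psiP psiP' E; apply: identification_ind.
- by rewrite !star_morphism1.
- by move=> k f g fE gE; rewrite !star_morphismD// !star_morphismZ// fE gE.
- by move=> f g fE gE; rewrite !star_morphismM// fE gE.
- by move=> f fE; rewrite !star_morphism_star// fE.
- exact: E.
- move=> f; apply: (uniform_lipschitz_eq (C := 1)) => g h e e0 gh;
    by rewrite mul1r; exact: lipschitz_star_morphism.
Qed.

End Identification.

(** * Noncommutative spheres *)

Section SphereRelations.
Variables (R : realType) (N : nat) (x : sphere_kind).
Implicit Types (Z : nc_space R N).

(** The sharp relations give [a b^* c = a c^* b = c a^* b = c b^* a]. *)
Lemma kind_star_relations Z : kind_relations x Z -> star_relations Z.
Proof.
have ds : double_star_relations Z -> star_relations Z.
  move=> D z0 i j k; apply: D; [by left; exists i|by right; exists j|by left;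
    exists k].
have sh : sharp_relations Z -> star_relations Z.
  move=> D z0 i j k; rewrite -smulA (D j k).2 smulA (D i k).1 -smulA (D i j).2.
  by rewrite smulA.
by case: x => //= [[]].
Qed.

(** A morphism from [Z] to this space is an antimorphism of the algebra of [Z] sending each [z_i] to
    its adjoint. *)
Definition opposite_space Z : nc_space R N :=
  @NCSpace R N (opposite_alg Z) (fun i => (nc_coord Z i)^*').

Lemma nc_morphism_relations (Y Z : nc_space R N) (f : Y -> Z) : nc_morphism f ->
  sphere_kind_relations x Y -> sphere_kind_relations x Z.
Proof.
move=> fP [[s1 s2] Yx]; have fS := nc_morphism_star fP.
have fz i : nc_coord Z i = f (nc_coord Y i) by rewrite (nc_morphism_coord fP).
have fzs i : (nc_coord Z i)^*' = f (nc_coord Y i)^*'.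
  by rewrite (star_morphism_star fS) -fz.
split.
  split; rewrite -[RHS](star_morphism1 fS); [rewrite -s1|rewrite -s2];
    rewrite (star_morphism_sum fS); apply: eq_bigr => i _;
    by rewrite fzs fz -(star_morphismM fS).
have ds : double_star_relations Y -> double_star_relations Z.
  have sw a : (range (nc_coord Z) `|` range (fun i => (nc_coord Z i)^*')) a ->
      exists2 b, (range (nc_coord Y) `|` range (fun i =>
        (nc_coord Y i)^*')) b & a = f b.
    case=> -[i _ <-]; [exists (nc_coord Y i)|exists (nc_coord Y i)^*'] => //.
      by left; exists i.
    by right; exists i.
  move=> D G a b c /sw[a' Ga ->] /sw[b' Gb ->] /sw[c' Gc ->].
  by rewrite -!(star_morphismM fS) D.
have sh : sharp_relations Y -> sharp_relations Z.
  move=> D z0 i j; rewrite /z0 !fzs !fz -!(star_morphismM fS).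
  by have [-> ->] := D i j.
have st : star_relations Y -> star_relations Z.
  move=> D z0 i j k; rewrite /z0 !fzs !fz -!(star_morphismM fS).
  by rewrite D.
by case: x Yx => //= -[? ?]; split; [exact: sh|exact: ds].
Qed.

Lemma opposite_space_relations Z :
  sphere_kind_relations x Z -> sphere_kind_relations x (opposite_space Z).
Proof.
move=> [[s1 s2] Zx].
have opM (a b : opposite_space Z) : a ⋅ b = (b : Z) ⋅ (a : Z) by [].
have opS (a : opposite_space Z) : a^*' = (a : Z)^*' by [].
split.
  split; rewrite -[RHS]/(sone : Z).
    by rewrite -[RHS]s1; apply: eq_bigr => i _; rewrite opM opS /= starK.
  by rewrite -[RHS]s2; apply: eq_bigr => i _; rewrite opM opS /= starK.
have ds : double_star_relations Z -> double_star_relations (opposite_space Z).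
  have sw (a : Z) : (range (nc_coord (opposite_space Z)) `|`
      range (fun i => (nc_coord (opposite_space Z) i)^*')) a ->
      (range (nc_coord Z) `|` range (fun i => (nc_coord Z i)^*')) a.
    case=> -[i _ <-]; first by right; exists i.
    by left; exists i => //; rewrite opS /= starK.
  move=> D G a b c /sw Ga /sw Gb /sw Gc; rewrite !opM !smulA.
  exact: D.
have sh : sharp_relations Z -> sharp_relations (opposite_space Z).
  by move=> D z0 i j; rewrite !opM !opS /= !starK; have [] := D j i.
have st : star_relations Z -> star_relations (opposite_space Z).
  move=> D z0 i j k; rewrite !opM !opS /= !starK !smulA.
  have := congr1 star (D i j k); rewrite !starM !starK !smulA.
  by move=> ->.
by case: x Zx => //= -[? ?]; split; [exact: sh|exact: ds].
Qed.

(** A morphism from a sphere to this space is evaluation at the point [z], a character. *)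
Definition point_space (z : 'cV[R[i]]_N) : nc_space R N :=
  @NCSpace R N R[i] (fun i => z i 0).

Lemma point_space_relations (z : 'cV[R[i]]_N) : csphere R N z ->
  match x with DoubleStar | Star => True | _ => torus_rsphere R N z end ->
  sphere_kind_relations x (point_space z).
Proof.
move=> z1 zt; have mE (a b : R[i]) : a ⋅ b = a * b by [].
have sE (a : R[i]) : a^*' = a^* by [].
split.
  split; rewrite -[RHS]z1; apply: eq_bigr => i _; rewrite mE sE /=.
    by rewrite normCK.
  by rewrite normCKC.
have ds : double_star_relations (point_space z).
  by move=> a b c _ _ _; rewrite !mE -mulrA mulrC [b * c]mulrC.
have st : star_relations (point_space z).
  by move=> i j k; rewrite !mE !sE /= -mulrA mulrC [_ * z k 0]mulrC.
have sh : torus_rsphere R N z -> sharp_relations (point_space z).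
  move=> /torus_rankone_real D z0 i j; rewrite !mE !sE /=; split;
    first exact: D.
  by rewrite mulrC [RHS]mulrC; exact: D.
by case: x zt => zt; [exact: ds|exact: st|split;
  [exact: sh|exact: ds]|exact: sh].
Qed.

End SphereRelations.

Section SphereTheory.
Variables (R : realType) (N : nat) (x : sphere_kind) (S : nc_space R N).
Hypothesis hS : nc_sphere x S.

Lemma nc_sphere_hom (Z : nc_space R N) : sphere_kind_relations x Z ->
  exists f : S -> Z, nc_morphism f.
Proof. by move=> /(hS.2 Z)[f [fP _]]; exists f. Qed.

Lemma nc_sphere_eq (Z : nc_space R N) (f g : S -> Z) :
  sphere_kind_relations x Z -> nc_morphism f -> nc_morphism g -> f = g.
Proof. by move=> /(hS.2 Z)[h [_ hu]] /hu <- /hu <-. Qed.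

(** Universality gives a morphism to the opposite space; its square is an endomorphism fixing the
    coordinates, hence the identity by uniqueness. *)
Lemma nc_sphere_antiautomorphism : exists2 f : S -> S,
  star_antiautomorphism f & (forall i, f (nc_coord S i) = (nc_coord S i)^*') /\
    involutive f.
Proof.
have [f fP] := nc_sphere_hom (opposite_space_relations hS.1).
have [fl f1 fM fS] := nc_morphism_star fP; have fz := nc_morphism_coord fP.
have fK : involutive (f : S -> S).
  suff E : (f : S -> S) \o (f : S -> S) = id.
    by move=> a; exact: (congr1 (fun h => h a) E).
  apply: (@nc_sphere_eq S) => //; first exact: hS.1.
  - split=> [|i]; last first.
      have := fS (nc_coord S i); rewrite /= (fz i) => fzs.
      by rewrite [LHS]fzs; exact: starK.
    split => /=.
    + move=> k a b /=; rewrite (fl k a b); exact: (fl k (f a) (f b)).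
    + by rewrite f1; exact: f1.
    + by move=> a b /=; rewrite (fM a b); exact: (fM (f b) (f a)).
    + by move=> a /=; rewrite (fS a); exact: (fS (f a)).
exists (f : S -> S); last by split.
split; [exact: (Bijective fK fK)|exact: fl|exact: f1|exact: fM|exact: fS].
Qed.

End SphereTheory.

(** * The lift *)

Section Lift.
Variables (R : realType) (N : nat) (x : sphere_kind) (X : set 'cV[R[i]]_N).
Variables (S : nc_space R N) (ip iq : cfun R (kind_proj_space R N x) -> S).
Hypotheses (Xs : X `<=` csphere R N) (cX : closed X) (XO2 : O2_invariant X).
Hypotheses (hS : nc_sphere x S) (hip : projective_identification ip).
Hypothesis hiq : coordinate_embedding (qcoord S) iq.

Local Notation P := (kind_proj_space R N x).
Local Notation PX := (kind_projective x X).
Local Notation z := (nc_coord S).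
Local Notation V := (vanishing P PX).
Local Notation K := (ideal_generated (ip @` V `|` iq @` V)).

Let ipP := identification_star hip.
Let iqP := coordinate_embedding_star hiq.

Lemma lipschitz_mulr (psi : cfun R P -> S) (a : S) : star_morphism psi ->
  forall (g h : cfun R P) (e : R), 0 <= e ->
    (forall p, nrm (g p - h p) <= e) ->
      nrm (psi g ⋅ a - psi h ⋅ a) <= nrm a * e.
Proof.
move=> psiP g h e e0 gh; rewrite -smulBl; apply: (le_trans (nrmM _ _)).
by rewrite mulrC ler_wpM2l ?nrm_ge0//; apply: lipschitz_star_morphism.
Qed.

Lemma lipschitz_mull (psi : cfun R P -> S) (a : S) : star_morphism psi ->
  forall (g h : cfun R P) (e : R), 0 <= e ->
    (forall p, nrm (g p - h p) <= e) ->
      nrm (a ⋅ psi g - a ⋅ psi h) <= nrm a * e.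
Proof.
move=> psiP g h e e0 gh; rewrite -smulBr; apply: (le_trans (nrmM _ _)).
by rewrite ler_wpM2l ?nrm_ge0//; apply: lipschitz_star_morphism.
Qed.

(** The two identities go through the induction together because the adjoint case exchanges them:
    the first for [f^*] is the adjoint of the second for [f]. *)
Lemma pq_intertwine f : forall k,
  ip f ⋅ z k = z k ⋅ iq f /\ iq f ⋅ (z k)^*' = (z k)^*' ⋅ ip f.
Proof.
have st := kind_star_relations hS.1.2.
elim/(identification_ind hip): f =>
  [|l f g IHf IHg|f g IHf IHg|f IHf|i j|f IHf] k.
- by rewrite (star_morphism1 ipP) (star_morphism1 iqP) !smul1l !smul1r.
- have [f1 f2] := IHf k; have [g1 g2] := IHg k.
  rewrite !(star_morphismD ipP, star_morphismZ ipP, star_morphismD iqP,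
    star_morphismZ iqP).
  by rewrite !(smulDl, smulDr, smulZl, smulZr) f1 f2 g1 g2.
- have [f1 f2] := IHf k; have [g1 g2] := IHg k.
  rewrite (star_morphismM ipP) (star_morphismM iqP).
  by split; rewrite -smulA ?g1 ?g2 smulA ?f1 ?f2 -smulA.
- have [f1 f2] := IHf k.
  rewrite (star_morphism_star ipP) (star_morphism_star iqP).
  split; last by rewrite -!starM f1.
  by have := congr1 star f2; rewrite !starM starK.
- rewrite identification_coord// (coordinate_embedding_coord hiq) /pcoord
    /qcoord.
  split; first by rewrite st smulA.
  have := congr1 star (st k i j); rewrite !starM !starK !smulA => <-.
  by [].
- split.
    apply: (@uniform_lipschitz_eq _ _ _ (fun f => ip f ⋅ z k) (fun f =>
      z k ⋅ iq f)
      (nrm (z k))).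
    + exact: lipschitz_mulr.
    + exact: lipschitz_mull.
    + by move=> e /IHf[g Qg fg]; exists g => //; have [] := Qg k.
  apply: (@uniform_lipschitz_eq _ _ _ (fun f => iq f ⋅ (z k)^*')
    (fun f => (z k)^*' ⋅ ip f) (nrm (z k)^*')).
  + exact: lipschitz_mulr.
  + exact: lipschitz_mull.
  + by move=> e /IHf[g Qg fg]; exists g => //; have [] := Qg k.
Qed.

Lemma iqE f : iq f = \sum_k (z k)^*' ⋅ ip f ⋅ z k.
Proof.
rewrite -[LHS]smul1l -hS.1.1.2 smul_suml; apply: eq_bigr => k _.
by rewrite -smulA -(pq_intertwine f k).1 smulA.
Qed.

Let cK : closed_ideal K := ideal_generated_closed_ideal _.

Lemma lift_ideal_ip f : V f -> K (ip f).
Proof.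
move=> Vf; have : (ip @` V `|` iq @` V) (ip f) by left; exists f.
exact: sub_smallest.
Qed.

Lemma lift_ideal_sub (C : set S) : closed_ideal C ->
  (forall f, V f -> C (ip f)) -> K `<=` C.
Proof.
move=> CP CV; apply: smallest_sub => // _ [[f Vf <-]|[f Vf <-]];
  first exact: CV.
rewrite iqE; apply: ideal_sum => // k.
by apply: (Defs.idealMr CP); apply: (idealMl CP); exact: CV.
Qed.

Let sK a : K a -> K a^*'.
Proof.
apply: ideal_generated_star => _ [[f Vf <-]|[f Vf <-]]; [left|right].
  exists f^*'; last exact: star_morphism_star.
  by move=> p pX; rewrite cfun_starE Vf// rmorph0.
exists f^*'; last exact: star_morphism_star.
by move=> p pX; rewrite cfun_starE Vf// rmorph0.
Qed.

Definition lift_space : nc_space R N :=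
  @NCSpace R N (cstar_quot cK sK) (fun i => quot_proj cK sK (z i)).
Local Notation Z := lift_space.

Definition lift_proj : S -> Z := quot_proj cK sK.
Local Notation pi := lift_proj.

Lemma lift_proj_morphism : nc_morphism pi.
Proof.
split=> //; split.
- by move=> l a b; rewrite /lift_proj quot_projD quot_projZ.
- by [].
- exact: quot_projM.
- exact: quot_proj_star.
Qed.
Let piP := nc_morphism_star lift_proj_morphism.

Lemma lift_proj_surj : range pi = setT.
Proof.
by apply/seteqP; split=> // a _; have [b ->] := quot_surj a; exists b.
Qed.

Lemma lift_proj0 a : pi a = 0 <-> K a.
Proof. exact: quot_proj0. Qed.

Lemma lift_universal (Y : nc_space R N) (f : S -> Y) :
  nc_morphism f -> (forall g, V g -> f (ip g) = 0) -> nc_subspace Y Z.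
Proof.
move=> fP fV; have fS := nc_morphism_star fP.
have fK : K `<=` [set a | f a = 0].
  by apply: lift_ideal_sub => //; exact: star_morphism_kernel.
have fE a : f (sval (pi a)) = f a.
  apply/eqP; rewrite eq_sym -subr_eq0 -(star_morphismB fS); apply/eqP/fK.
  exact: quot_reprP.
exists (fun y : Z => f (sval y)); split=> [|i]; last first.
  by rewrite fE (nc_morphism_coord fP).
have lift (y : Z) : exists a, y = pi a by exact: quot_surj.
split.
- move=> l a b; have [a' ->] := lift a; have [b' ->] := lift b.
  rewrite -(star_morphismZ piP) -(star_morphismD piP) !fE.
  by rewrite (star_morphismD fS) (star_morphismZ fS).
- by rewrite -(star_morphism1 piP) fE (star_morphism1 fS).
- move=> a b; have [a' ->] := lift a; have [b' ->] := lift b.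
  by rewrite -(star_morphismM piP) !fE (star_morphismM fS).
- move=> a; have [a' ->] := lift a.
  by rewrite -(star_morphism_star piP) !fE (star_morphism_star fS).
Qed.

(** * Restriction from [P] to [PX] and the projective version of the quotient *)

Let PXP : PX `<=` P := @kind_projective_sub R N x X Xs.

Definition incl (q : PX) : P :=
  exist _ (set_val q) (mem_set (PXP (set_valP q))).

Lemma incl_continuous : continuous incl.
Proof.
apply/continuousP => _ [B oB <-].
by apply: (continuousP _).1 oB; exact: initial_continuous.
Qed.

Fact res_continuous (f : cfun R P) : continuous (fun q : PX => f (incl q)).
Proof.
move=> q; apply: (@continuous_comp _ _ _ incl f); first exact: incl_continuous.
exact: cfun_continuous.
Qed.

Definition res (f : cfun R P) : cfun R PX := mkcfun (@res_continuous f).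

Lemma resE f q : res f q = f (incl q). Proof. by []. Qed.

Lemma res_star : star_morphism res.
Proof. by split=> [k f g||f g|f]; apply: cfunP. Qed.

(** A function on [PX] reaches C(S) only through an extension to [P]; [PX] being closed, the Tietze
    theorem on the whole matrix space provides one. *)
Lemma res_surj (f : cfun R PX) : exists F, res F = f.
Proof.
have cPX := @kind_projective_closed R N x X Xs cX XO2.
have [g cg gE] :=
  tietze_complex (@complex_pseudometric_normal R 'M[R[i]]_N) cPX f.
have cF : continuous (fun p : P => g (set_val p)).
  move=> p; apply: (@continuous_comp _ _ _ (set_val : P -> _) g);
    last exact: cg.
  exact: initial_continuous.
by exists (mkcfun cF); apply: cfunP => q; rewrite -gE.
Qed.

Lemma vanishing_res f : V f <-> res f = 0.
Proof.
split=> [Vf|f0 p pX].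
  by apply: cfunP => q; rewrite resE Vf//; exact: (set_valP q).
pose q : PX := exist _ (set_val p) (mem_set pX).
have -> : p = incl q by apply: val_inj.
by rewrite -resE f0.
Qed.

Lemma eval_star (p : P) : star_morphism (fun f : cfun R P => f p : R[i]).
Proof. by []. Qed.

(** The implication to the right is what makes C(PX) embed into the quotient; it says that the ideal
    meets the range of [ip] in [I] only. *)
Lemma lift_ideal_ipE f : K (ip f) <-> V f.
Proof.
split=> [Kf p pX|]; last exact: lift_ideal_ip.
have [w [Xw pw wt]] := kind_projectiveP pX.
have [chi chiP] := nc_sphere_hom hS (point_space_relations (Xs Xw) wt).
have chiS := nc_morphism_star chiP.
have E : chi \o ip =1 (fun f : cfun R P => f p : R[i]).
  apply: (identification_eq hip) => [||i j].
  - exact: star_morphism_comp.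
  - exact: eval_star.
  - rewrite /= identification_coord// /pcoord (star_morphismM chiS).
    rewrite (star_morphism_star chiS) !(nc_morphism_coord chiP) /=.
    by rewrite -[RHS]/((set_val p : 'M[R[i]]_N) i j) pw mxE.
have : K `<=` [set a | chi a = 0].
  apply: lift_ideal_sub; first exact: star_morphism_kernel.
  by move=> g Vg; rewrite /= -[LHS]/((chi \o ip) g) E; exact: Vg.
by move=> /(_ _ Kf) /=; rewrite -[X in X = _]/((chi \o ip) f) E.
Qed.

(** The map [g] sends [f] to the class of [ip F] for a chosen extension [F]. Two extensions differ
    by a vanishing function, so the choice is immaterial, and this is what makes [g] a
    star-morphism. *)
Lemma lift_projective_version : projective_version Z PX.
Proof.
have [ext extK] : {ext : cfun R PX -> cfun R P & forall f, res (ext f) = f}.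
  by apply: (@choice _ _ (fun f F => res F = f)) => f; exact: res_surj.
pose g f := pi (ip (ext f)).
have gE F : g (res F) = pi (ip F).
  have VF : V (ext (res F) - F).
    by apply/vanishing_res; rewrite (star_morphismB res_star) extK subrr.
  apply/eqP; rewrite -subr_eq0 -(star_morphismB piP) -(star_morphismB ipP).
  by apply/eqP/lift_proj0; exact: lift_ideal_ip.
have gP : star_morphism g.
  split.
  - move=> l f h; rewrite -(extK f) -(extK h) -(star_morphismZ res_star).
    rewrite -(star_morphismD res_star) !gE (star_morphismD ipP) (star_morphismZ
      ipP).
    by rewrite (star_morphismD piP) (star_morphismZ piP).
  - by rewrite -(star_morphism1 res_star) gE (star_morphism1 ipP)
      (star_morphism1 piP).
  - move=> f h; rewrite -(extK f) -(extK h) -(star_morphismM res_star) !gE.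
    by rewrite (star_morphismM ipP) (star_morphismM piP).
  - move=> f; rewrite -(extK f) -(star_morphism_star res_star) !gE.
    by rewrite (star_morphism_star ipP) (star_morphism_star piP).
have gi : injective g.
  move=> f h; rewrite -(extK f) -(extK h) !gE => /eqP.
  rewrite -subr_eq0 -(star_morphismB piP) -(star_morphismB ipP) => /eqP.
  move=> /lift_proj0 /lift_ideal_ipE /vanishing_res.
  by rewrite (star_morphismB res_star) => /eqP; rewrite subr_eq0 => /eqP.
have gc i j : g (coordinate PX i j) = pcoord Z i j.
  have -> : coordinate PX i j = res (coordinate P i j) by apply: cfunP.
  rewrite gE identification_coord// (star_morphismM piP) (star_morphism_star
    piP).
  by rewrite !(nc_morphism_coord lift_proj_morphism).
exists g; split=> //; apply/seteqP; split; last first.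
  apply: smallest_sub => [|_ [i _ [j _ <-]]];
    last by exists (coordinate PX i j).
  split.
  - by exists sone => //; exact: star_morphism1.
  - move=> k _ _ [f _ <-] [h _ <-]; exists (k *: f + h) => //.
    exact: (star_morphism_linear gP).
  - move=> _ _ [f _ <-] [h _ <-]; exists (f ⋅ h) => //.
    exact: (star_morphismM gP).
  - move=> _ [f _ <-]; exists f^*' => //; exact: (star_morphism_star gP).
  - exact: injective_range_closed.
(* Conversely, [ip (ext f)] lies in the algebra generated by the [p_ij] of [S], and the preimage
   under [pi] of the algebra generated in the quotient is a closed subalgebra containing them. *)
move=> _ [f _ <-]; rewrite -(extK f) gE.
have : range ip (ip (ext f)) by exists (ext f).
rewrite hip.2; set G := [set pcoord Z i j | i in setT & j in setT].
have GP := cstar_generated_subalgebra G.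
suff : cstar_generated [set pcoord S i j | i in setT & j in setT] `<=`
    pi @^-1` cstar_generated G by apply.
apply: smallest_sub => [|_ [i _ [j _ <-]]]; last first.
  have : G (pi (pcoord S i j)); last exact: sub_smallest.
  exists i => //; exists j => //.
  rewrite /pcoord (star_morphismM piP) (star_morphism_star piP).
  by rewrite !(nc_morphism_coord lift_proj_morphism).
split.
- by rewrite /= (star_morphism1 piP); exact: (subalg1 GP).
- move=> k a b /= Ga Gb; rewrite (star_morphismD piP) (star_morphismZ piP).
  exact: (subalgP GP).
- by move=> a b /= Ga Gb; rewrite (star_morphismM piP); exact: (subalgM GP).
- by move=> a /= Ga; rewrite (star_morphism_star piP); exact: (subalg_star GP).
- apply: (@closed_preimage_nrm _ S Z pi); last exact: (Defs.subalg_closed GP).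
  by move=> a b; rewrite -(star_morphismB piP); exact: star_morphism_nrm.
Qed.

Definition tr_point (p : P) : P :=
  exist _ (set_val p)^T (mem_set (kind_proj_tr (set_valP p))).

Lemma tr_point_continuous : continuous tr_point.
Proof.
apply: continuous_comp_initial => p.
apply: (@continuous_comp _ _ _ (set_val : P -> _) (@trmx R[i] N N)).
  exact: initial_continuous.
move: (set_val p) => q; apply: (@cvg_mx R _ _ N N _ q^T (nbhs_filter q)) => i j.
rewrite mxE; under eq_fun do rewrite mxE.
exact: cvg_coord.
Qed.

Fact tr_continuous (f : cfun R P) : continuous (fun p : P => f (tr_point p)).
Proof.
move=> q; apply: (@continuous_comp _ _ _ tr_point f);
  first exact: tr_point_continuous.
exact: cfun_continuous.
Qed.

Definition tr_cfun (f : cfun R P) : cfun R P := mkcfun (@tr_continuous f).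

Lemma tr_cfunE f p : tr_cfun f p = f (tr_point p). Proof. by []. Qed.

Lemma vanishing_tr f : V f -> V (tr_cfun f).
Proof. by move=> Vf p pX; rewrite tr_cfunE Vf//; exact: kind_projective_tr. Qed.

(** * Conjugation-stability of the quotient *)

Section AntiAutomorphism.
Variable phi : S -> S.
Hypotheses (phiA : star_antiautomorphism phi) (phiK : involutive phi).
Hypothesis phiz : forall i, phi (z i) = (z i)^*'.

Let phiO : star_morphism (phi : S -> opposite_alg S).
Proof.
split; [exact: (antiauto_linear phiA)|exact: (antiauto1 phiA)|exact: (antiautoM
  phiA)|].
exact: (antiauto_star phiA).
Qed.

Lemma antiautoD a b : phi (a + b) = phi a + phi b.
Proof. exact: (star_morphismD phiO). Qed.

Lemma antiautoZ l a : phi (l *: a) = l *: phi a.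
Proof. exact: (star_morphismZ phiO). Qed.

Lemma antiauto_nrm a b : nrm (phi a - phi b) <= nrm (a - b).
Proof.
have := star_morphism_nrm phiO (a - b).
by rewrite (star_morphismB phiO).
Qed.

(** On coordinates, [phi] sends [z_i z_j^*] to [z_j z_i^*], that is [p_ij] to [p_ji]; the reversal
    of products is absorbed by the commutativity of C(P). *)
Lemma antiauto_ip f : phi (ip f) = ip (tr_cfun f).
Proof.
elim/(identification_ind hip): f => [|l f g fE gE|f g fE gE|f fE|i j|f fE].
- rewrite (_ : tr_cfun sone = sone); last by apply: cfunP.
  by rewrite (star_morphism1 ipP) (antiauto1 phiA).
- rewrite (_ : tr_cfun _ = l *: tr_cfun f + tr_cfun g); last by apply: cfunP.
  rewrite !(star_morphismD ipP) !(star_morphismZ ipP) antiautoD antiautoZ.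
  by rewrite fE gE.
- rewrite (_ : tr_cfun _ = tr_cfun g ⋅ tr_cfun f); last first.
    by rewrite cfunC; apply: cfunP.
  by rewrite !(star_morphismM ipP) (antiautoM phiA) fE gE.
- rewrite (_ : tr_cfun _ = (tr_cfun f)^*'); last by apply: cfunP.
  by rewrite !(star_morphism_star ipP) (antiauto_star phiA) fE.
- rewrite (_ : tr_cfun _ = coordinate P j i); last first.
    by apply: cfunP => p; rewrite tr_cfunE -[LHS]/((set_val p)^T i j) mxE.
  rewrite !identification_coord// /pcoord (antiautoM phiA) (antiauto_star phiA).
  by rewrite !phiz starK.
- apply: (@uniform_lipschitz_eq _ _ _ (fun f => phi (ip f)) (fun f =>
    ip (tr_cfun f)) 1).
  + move=> g h e e0 gh; rewrite mul1r; apply: (le_trans (antiauto_nrm _ _)).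
    exact: lipschitz_star_morphism.
  + move=> g h e e0 gh; rewrite mul1r; apply: lipschitz_star_morphism => // p.
    by rewrite !tr_cfunE.
  + exact: fE.
Qed.

Lemma lift_ideal_antiauto a : K a -> K (phi a).
Proof.
suff : K `<=` phi @^-1` K by apply.
apply: lift_ideal_sub => [|f Vf]; last first.
  by rewrite /= antiauto_ip; apply: lift_ideal_ip; exact: vanishing_tr.
split.
- by rewrite /= (star_morphism0 phiO); exact: (ideal0 cK).
- by move=> b c /= Kb Kc; rewrite antiautoD; exact: (idealD cK).
- by move=> b c /= Kc; rewrite (antiautoM phiA); exact: (Defs.idealMr cK).
- by move=> b c /= Kb; rewrite (antiautoM phiA); exact: (idealMl cK).
- by apply: (closed_preimage_nrm antiauto_nrm); exact: (ideal_closed cK).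
Qed.

Lemma lift_conjugation_stable : conjugation_stable Z.
Proof.
pose psi (y : Z) : Z := pi (phi (sval y)).
have psiE a : psi (pi a) = pi (phi a).
  apply/eqP; rewrite -subr_eq0 -(star_morphismB piP); apply/eqP/lift_proj0.
  rewrite -[phi _ - phi _](star_morphismB phiO); apply: lift_ideal_antiauto.
  by apply: (ideal_subC cK); exact: (quot_reprP cK).
have lift (y : Z) : exists a, y = pi a by exact: quot_surj.
exists psi => [|i]; last first.
  rewrite -(nc_morphism_coord lift_proj_morphism) psiE phiz.
  exact: (star_morphism_star piP).
split.
- have psiK : involutive psi.
    by move=> y; have [a ->] := lift y; rewrite !psiE phiK.
  exact: (Bijective psiK psiK).
- move=> l a b; have [a' ->] := lift a; have [b' ->] := lift b.
  rewrite -(star_morphismZ piP) -(star_morphismD piP) !psiE antiautoD antiautoZ.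
  by rewrite (star_morphismD piP) (star_morphismZ piP).
- by rewrite -(star_morphism1 piP) psiE (antiauto1 phiA).
- move=> a b; have [a' ->] := lift a; have [b' ->] := lift b.
  by rewrite -(star_morphismM piP) !psiE (antiautoM phiA) (star_morphismM piP).
- move=> a; have [a' ->] := lift a.
  by rewrite -(star_morphism_star piP) !psiE (antiauto_star phiA)
    (star_morphism_star piP).
Qed.

End AntiAutomorphism.

(** Both [f \o ip] and [h \o res] are star-morphisms from C(P) sending the coordinates to the [p_ij]
    of [Y]; they are therefore equal, and [res] kills vanishing functions. *)
Lemma lift_candidate_vanishing (Y : nc_space R N) (f : S -> Y) :
  projective_version Y PX -> nc_morphism f -> forall g, V g -> f (ip g) = 0.
Proof.
move=> [h hP] fP g Vg; have fS := nc_morphism_star fP.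
have hS' := identification_star hP.
have E : f \o ip =1 h \o res.
  apply: (identification_eq hip) => [||i j].
  - exact: star_morphism_comp.
  - by apply: star_morphism_comp => //; exact: res_star.
  - rewrite /= identification_coord// (_ : res _ = coordinate PX i j);
      last by apply: cfunP.
    rewrite identification_coord// /pcoord (star_morphismM fS)
      (star_morphism_star fS).
    by rewrite !(nc_morphism_coord fP).
rewrite -[LHS]/((f \o ip) g) E /=.
by have /vanishing_res -> := Vg; exact: star_morphism0.
Qed.

Lemma lift_conjugation_stable_lift : conjugation_stable_lift S PX Z.
Proof.
split; first split.
- by exists pi; [exact: lift_proj_morphism|exact: lift_proj_surj].
- have [phi phiA [phiz phiK]] := nc_sphere_antiautomorphism hS.
  exact: (lift_conjugation_stable phiA phiK phiz).
- exact: lift_projective_version.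
- move=> Y [[f fP _] _ PY]; apply: (lift_universal fP).
  exact: lift_candidate_vanishing.
Qed.

Lemma conjugation_stable_lift_quotient (Y : nc_space R N) :
  conjugation_stable_lift S PX Y -> nc_quotient K Y.
Proof.
move=> [[[f fP fsurj] _ PY] maxY]; exists f; split => //.
have fV := lift_candidate_vanishing PY fP.
apply/seteqP; split=> [a /= fa0|]; last first.
  apply: (lift_ideal_sub (C := f @^-1` [set 0])) => //.
  exact: (star_morphism_kernel (nc_morphism_star fP)).
(* The quotient is itself a candidate, so maximality of [Y] gives [h] from [Y] to it. By uniqueness
   [h \o f] is the projection, hence whatever [f] kills lies in the ideal. *)
have [h hP] := maxY Z lift_conjugation_stable_lift.1.
have hS' := nc_morphism_star hP.
have Zx := nc_morphism_relations lift_proj_morphism hS.1.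
have hfP : nc_morphism (h \o f).
  split; first by apply: star_morphism_comp => //; exact: nc_morphism_star.
  by move=> i /=; rewrite (nc_morphism_coord fP) (nc_morphism_coord hP).
have hf := nc_sphere_eq hS Zx hfP lift_proj_morphism.
by apply/lift_proj0; rewrite -hf /= fa0 (star_morphism0 hS').
Qed.

End Lift.

Theorem proposition5p4 (R : realType) (N : nat) (x : sphere_kind)
    (X : set 'cV[R[i]]_N) (S : nc_space R N)
    (ip iq : cfun R (kind_proj_space R N x) -> S)
    (hXsphere : X `<=` csphere R N) (hXclosed : closed X)
    (hXO2 : O2_invariant X)
    (hS : nc_sphere x S)
    (hip : projective_identification ip)
    (hiq : coordinate_embedding (qcoord S) iq) :
  let PX := kind_projective x X in
  let I := ip @` vanishing (kind_proj_space R N x) PX in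
  let J := iq @` vanishing (kind_proj_space R N x) PX in
  (exists Z : nc_space R N, conjugation_stable_lift S PX Z) /\
  (forall Z : nc_space R N, conjugation_stable_lift S PX Z ->
     nc_quotient (ideal_generated (I `|` J)) Z).
Proof.
move=> PX I J; split; last by move=> Z; exact: conjugation_stable_lift_quotient.
by exists (lift_space X hip hiq); exact: lift_conjugation_stable_lift.
Qed.
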